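(* Let $X=\{X_n\}$ be a stationary ergodic process and $Y=\{Y_n\}$ an i.i.d. process with marginal distribution $Q$, both with values in the same finite alphabet $A$. Assume that $\rho(x,y)=0$ if and only if $x=y$, and that $Q(x)>0$ for all $x\in A$. Then the following double limit exists and satisfies $$\lim_{n\to\infty,\;D\downarrow0}\ \frac1n\log\frac{P_n(B(X_1^n,D))}{Q^n(B(X_1^n,D))}=H(\mathbb P\|\mathbb Q)\quad\text{with probability one,}$$ that is, the limit is the same regardless of how $n$ grows to infinity and $D$ decreases to zero. In particular, the repeated limit $\lim_{n\to\infty}\lim_{D\downarrow0}$ of the same expression exists with probability one and is equal to $H(\mathbb P\|\mathbb Q)$.
   Context: $P_n$ is the distribution of $X_1^n=(X_1,\dots,X_n)$ on $A^n$, $Q^n$ is the $n$-fold product of $Q$, and $\mathbb P,\mathbb Q$ are the distributions of the processes $X,Y$. $\rho:A\times A\to[0,\infty)$, $\rho_n(x_1^n,y_1^n)=\frac1n\sum_{i=1}^n\rho(x_i,y_i)$, $B(x_1^n,D)=\{y_1^n\in A^n:\rho_n(x_1^n,y_1^n)\le D\}$. $\log$ is the natural logarithm. $H(\mathbb P\|\mathbb Q)$ is the relative entropy rate: with $f_n=dP_n/dQ^n$ and $H_n=E_{P_n}\big[\log\frac{f_n(X_1^n)}{f_{n-1}(X_1^{n-1})}\big]$ for $n\ge2$, $H(\mathbb P\|\mathbb Q)=\lim_{n\to\infty}H_n$. *)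

(* Defs.v *)
From HB Require Import structures.
From mathcomp Require Import all_boot all_order all_algebra finmap.
From mathcomp Require Import all_classical all_reals all_analysis.

Set Implicit Arguments.
Unset Strict Implicit.
Unset Printing Implicit Defensive.

Import Order.TTheory GRing.Theory Num.Theory.
Import numFieldNormedType.Exports.

Local Open Scope classical_set_scope.
Local Open Scope ring_scope.
Local Open Scope charge_scope.

Section path_space.
Context d (A : measurableType d).

Definition path_coordinate_events : set (set (nat -> A)) :=
  \bigcup_i preimage_set_system setT (fun x : nat -> A => x i) measurable.

(* The product sigma-algebra on A^N. *)
Definition path_measurable : set (set (nat -> A)) :=
  <<s path_coordinate_events >>.

Definition path_shift (x : nat -> A) : nat -> A := fun i => x i.+1.

End path_space.

(* Processes are indexed from 0: [X i] is the variable X_(i+1). *)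
Section processes.
Context dO (Omega : measurableType dO) d (A : measurableType d) (R : realType).
Variable P : probability Omega R.

Definition trajectory (X : nat -> {RV P >-> A}) (w : Omega) : nat -> A :=
  fun i => X i w.

Definition stationary (X : nat -> {RV P >-> A}) : Prop :=
  forall B : set (nat -> A), path_measurable B ->
    P (trajectory X @^-1` (@path_shift d A @^-1` B)) = P (trajectory X @^-1` B).

Definition ergodic (X : nat -> {RV P >-> A}) : Prop :=
  forall B : set (nat -> A), path_measurable B ->
    @path_shift d A @^-1` B = B ->
    P (trajectory X @^-1` B) = 0%E \/ P (trajectory X @^-1` B) = 1%E.

Definition mutually_independent (Y : nat -> {RV P >-> A}) : Prop :=
  forall (J : {fset nat}) (B : nat -> set A),
    (forall i, measurable (B i)) ->
    P (\bigcap_(i in [set` J]) (Y i @^-1` B i)) =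
    (\prod_(i <- J) P (Y i @^-1` B i))%E.

Definition iid_with_marginal (Y : nat -> {RV P >-> A})
    (Q : probability A R) : Prop :=
  mutually_independent Y /\
  forall (i : nat) (B : set A), measurable B -> distribution P (Y i) B = Q B.

Definition block (X : nat -> {RV P >-> A}) (n : nat) (w : Omega) :
  n.-tuple A := [tuple X i w | i < n].

Lemma measurable_block (X : nat -> {RV P >-> A}) (n : nat) :
  measurable_fun [set: Omega] (block X n).
Proof.
apply/measurable_fun_tnthP => i.
rewrite (_ : _ \o _ = X i); first exact: measurable_funPT.
by apply/funext => w /=; rewrite tnth_mktuple.
Qed.

HB.instance Definition _ (X : nat -> {RV P >-> A}) (n : nat) :=
  isMeasurableFun.Build _ _ _ _ (block X n) (@measurable_block X n).

Definition block_law (X : nat -> {RV P >-> A}) (n : nat) :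
  probability (n.-tuple A) R := distribution P (block X n).

End processes.

Section product_law.
Context d (A : measurableType d) (R : realType).

Definition tuple_cons (n : nat) (x : A * n.-tuple A) : n.+1.-tuple A :=
  [tuple of x.1 :: x.2].

Lemma measurable_tuple_cons (n : nat) :
  measurable_fun [set: A * n.-tuple A] (@tuple_cons n).
Proof. exact: (measurable_cons measurable_fst measurable_snd). Qed.

HB.instance Definition _ (n : nat) :=
  isMeasurableFun.Build _ _ _ _ (@tuple_cons n) (@measurable_tuple_cons n).

Fixpoint product_law (Q : probability A R) (n : nat) :
    probability (n.-tuple A) R :=
  match n with
  | 0 => \d_ [tuple]
  | m.+1 => distribution (Q \x product_law Q m)%E (@tuple_cons m)
  end.

Definition tuple_prefix (n : nat) (x : n.+1.-tuple A) : n.-tuple A :=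
  [tuple tnth x (widen_ord (leqnSn n) i) | i < n].

End product_law.

Section relative_entropy_rate.
Context dO (Omega : measurableType dO) d (A : measurableType d) (R : realType).
Variables (P : probability Omega R) (X : nat -> {RV P >-> A}).
Variable Q : probability A R.

Definition block_density (n : nat) : n.-tuple A -> \bar R :=
  'd (charge_of_finite_measure (block_law X n)) '/d (product_law Q n).

(* [entropy_increment n] is H_(n+1) = E_{P_(n+1)}[log (f_(n+1) / f_n)]. When
   P_(n+1) is absolutely continuous with respect to Q^(n+1), the default values
   of [fine], [ln] and division only matter on a P_(n+1)-null set. *)
Definition entropy_increment (n : nat) : \bar R :=
  'E_(block_law X n.+1)[fun x =>
     ln (fine (block_density x) / fine (block_density (tuple_prefix x)))]%E.

Definition relative_entropy_rate : \bar R := limn entropy_increment.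

End relative_entropy_rate.

Section distortion.
Context (A : Type) (R : realType) (rho : A -> A -> R).

Definition block_distortion (n : nat) (x y : n.-tuple A) : R :=
  n%:R^-1 * \sum_(i < n) rho (tnth x i) (tnth y i).

Definition distortion_ball (n : nat) (x : n.-tuple A) (D : R) :
  set (n.-tuple A) := [set y | block_distortion x y <= D].

End distortion.

(* If rho vanishes on the diagonal and 0 <= D, the ball contains its center, so
   for finite discrete A its P_n-probability is positive for almost every w. *)
Definition log_ball_ratio dO (Omega : measurableType dO) d
    (A : measurableType d) (R : realType) (P : probability Omega R)
    (X : nat -> {RV P >-> A}) (Q : probability A R) (rho : A -> A -> R)
    (w : Omega) (n : nat) (D : R) : R :=
  let B := distortion_ball rho (block X n w) D in
  n%:R^-1 * ln (fine (block_law X n B) / fine (product_law Q n B)).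

(* Main.v *)
Require Import Defs.
From HB Require Import structures.
From mathcomp Require Import all_boot all_order all_algebra finmap.
From mathcomp Require Import all_classical all_reals all_analysis.
From mathcomp Require Import measurable_realfun.
From mathcomp Require Import ring lra zify.

Set Implicit Arguments.
Unset Strict Implicit.
Unset Printing Implicit Defensive.

Import Order.TTheory GRing.Theory Num.Theory.
Import numFieldNormedType.Exports.

Local Open Scope classical_set_scope.
Local Open Scope ring_scope.

(** Write p(w) and q(w) for the probability of a word w under the process and
    under the product measure, and let w be the word formed by the first n
    letters of a typical trajectory. The theorem combines two facts:
    (1/n) log (p(w)/q(w)) tends to the relative entropy rate, and replacing w
    by a ball of small radius around w changes p(w) and q(w) only by factors
    exp(o(n)).

    The second fact ([ball_sum_small]) is a Markov inequality. For q,
    exponential tilting bounds the mass of the ball by q(w) exp(en). For p,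
    summing the tilted mass of the ball over all centres w gives at most
    exp(en), and a family of weights of total mass at most 1 cannot exceed
    p(w) by an exponential factor along a typical trajectory
    ([word_borel_cantelli]). Both bounds grow with the radius, so they hold
    for all D below some D0 at once, which is what a double limit needs. For
    fixed n only finitely many words compete, so the ball is constant for
    small D > 0 ([ball_sum_near0]); this gives the repeated limit.

    The first fact ([shannon_mcmillan_breiman]) starts from a zero-one law
    ([frequently_zero_one]): for each level c almost surely either
    p(w) < exp(cn) q(w) for all large n, or p(w) >= exp((c - e)n) q(w) for
    infinitely many n, for every e > 0. The key step
    ([frequently_likely_eventually]) turns infinitely many into all large n.
    Almost every start has a block of bounded length on which
    p >= exp((c - e)l) q, so a long word can be cut greedily into such blocks
    and a small proportion of single letters, by an ergodic estimate obtained
    from the same greedy cutting ([visits_upper]). The recursive weight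
    [packing_weight] has total mass at most 1 on words of each length and
    charges any such concatenation with the product of the p of its blocks,
    up to factors exp(en); by [word_borel_cantelli] the probability p(w) is
    nearly as large. So the limit exists and is constant, and it is identified
    by averaging: the mean of log (p/q) over words of length n is the sum of
    the first n entropy increments, which are nondecreasing
    ([entropy_step_le]) and bounded.

    All this takes place in an abstract ergodic measure-preserving system with
    a finite-valued letter function; the process is such a system on its path
    space. *)

(** * Elementary estimates *)

Lemma ln_le_subr1 (R : realType) (x : R) : 0 < x -> ln x <= x - 1.
Proof. by move=> x0; rewrite -{1}(subrKC 1 x) le_ln1Dx// ltrBrDr addrC subrr. Qed.

Lemma seq_positive_lower_bound (R : realFieldType) (I : eqType) (r : seq I)
    (f : I -> R) : (forall i, i \in r -> 0 < f i) ->
  exists m, 0 < m /\ forall i, i \in r -> m <= f i.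
Proof.
elim: r => [_|i r IH fr]; first by exists 1.
have [|m [m0 mr]] := IH; first by move=> k kr; rewrite fr// inE kr orbT.
exists (Num.min m (f i)); split; first by rewrite lt_min m0 fr ?mem_head.
move=> k; rewrite inE => /orP[/eqP ->|/mr mk]; first by rewrite ge_min lexx orbT.
by rewrite ge_min mk.
Qed.

Lemma small_multiple (R : realType) (D g : R) : 0 < g ->
  exists e, 0 < e /\ forall t, 0 <= t -> t < e -> D * t <= g.
Proof.
move=> g0; exists (g / (`|D| + 1)); split; first by rewrite divr_gt0// ltr_wpDl.
move=> t t0 te; apply: (@le_trans _ _ (`|D| * t)).
  by rewrite ler_wpM2r// ler_norm.
rewrite ltr_pdivlMr ?ltr_wpDl// in te.
by have := normr_ge0 D; move: te; nra.
Qed.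

Lemma geometric_block_le (R : realFieldType) (r : R) (m n : nat) :
  0 <= r < 1 -> \sum_(m <= l < n) r ^+ l <= r ^+ m / (1 - r).
Proof.
move=> /andP[r0 r1]; have r1' : 0 < 1 - r by rewrite subr_gt0.
have [mn|/ltnW nm] := leqP m n; last first.
  by rewrite big_geq// divr_ge0 ?exprn_ge0// ltW.
rewrite ler_pdivlMr// mulr_suml.
rewrite (eq_bigr (fun l => - r ^+ l.+1 - - r ^+ l)); last first.
  by move=> l _; rewrite exprS; ring.
rewrite telescope_sumr// opprK addrC gerBl.
by rewrite exprn_ge0.
Qed.

Lemma geometric_tail_small (R : realType) (r c : R) : 0 <= r < 1 -> 0 < c ->
  exists m, (0 < m)%N /\ r ^+ m / (1 - r) <= c.
Proof.
move=> /andP[r0 r1] c0; have r1' : 0 < 1 - r by rewrite subr_gt0.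
have cr : 0 < c * (1 - r) by rewrite mulr_gt0.
have nr1 : `|r| < 1 by rewrite ger0_norm.
have [m _ Hm] := cvgr_lt _ (cvg_expr nr1) _ cr.
exists m.+1; split => //; rewrite ler_pdivrMr//.
by apply/ltW/Hm => /=.
Qed.

(** * Almost sure convergence and measure *)

Section probability_limits.
Context d (T : measurableType d) (R : realType) (mu : probability T R).

Lemma ae_probability1 (E : set T) :
  measurable E -> mu E = 1%E -> \forall x \ae mu, E x.
Proof.
move=> mE muE; exists (~` E); split => //; first exact: measurableC.
by rewrite probability_setC// muE subee.
Qed.

Lemma ae_probability0 (E : set T) :
  measurable E -> mu E = 0%E -> \forall x \ae mu, ~ E x.
Proof. by move=> mE muE; exists E; split => // x /= /contrapT. Qed.

(** Almost sure convergence implies convergence in probability. *)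
Lemma near_probability_lt (F : (set T)^nat) :
  (forall n, measurable (F n)) -> (\forall x \ae mu, \forall n \near \oo, ~ F n x) ->
  forall e : R, 0 < e -> \forall n \near \oo, (mu (F n) < e%:E)%E.
Proof.
move=> mF aeF e e0.
have mlim : measurable (lim_sup_set F).
  by apply: bigcap_measurable => // k _; exact: bigcup_measurable.
have lim0 : mu (lim_sup_set F) = 0%E.
  apply: measure_negligible => //; apply: negligibleS aeF => x limx /= [m _ Fm].
  by have [n /= mn /(Fm n mn)] := limx m I.
have foo : (mu (\bigcup_(k >= 0) F k) < +oo)%E.
  by rewrite (le_lt_trans _ (ltey 1)) // probability_le1//; exact: bigcup_measurable.
have : mu (\bigcup_(k >= n) F k) @[n --> \oo] --> 0%E.
  by rewrite -lim0; exact: lim_sup_set_cvg.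
have e_nbhs : nbhs (0%E : \bar R) [set y | (y < e%:E)%E].
  exact: (@nbhs_open_ereal_lt _ 0 (fun=> e)).
move=> /(_ _ e_nbhs)[m _ Hm]; exists m => // n mn /=; apply: le_lt_trans (Hm n mn).
rewrite le_measure ?inE//; first exact: bigcup_measurable.
by move=> x Fx; exists n => /=.
Qed.

(** An almost surely finite waiting time is uniformly bounded outside a set of
    small measure. *)
Lemma late_probability_lt (G : (set T)^nat) :
  (forall n, measurable (G n)) ->
  (\forall x \ae mu, forall m, exists n, (m <= n)%N /\ G n x) ->
  forall (m : nat) (e : R), 0 < e ->
  exists l, (m <= l)%N /\
    (mu [set x | forall n, (m <= n <= l)%N -> ~ G n x] < e%:E)%E.
Proof.
move=> mG aeG m e e0.
pose F l := [set x | forall n, (m <= n <= l)%N -> ~ G n x].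
have FE l : F l = \bigcap_(n in [set n | (m <= n <= l)%N]) ~` G n by [].
have mF l : measurable (F l).
  by rewrite FE; apply: bigcap_measurableType => n _; exact: measurableC.
have : \forall x \ae mu, \forall l \near \oo, ~ F l x.
  apply: filterS aeG => x /(_ m)[n [mn Gn]]; exists n => // l /= nl /(_ n).
  by rewrite mn nl; exact.
move=> /(near_probability_lt mF)/(_ e e0)[N _ HN].
exists (maxn m N); split; first exact: leq_maxl.
by apply: (HN (maxn m N)) => /=; exact: leq_maxr.
Qed.

Lemma borel_cantelli_geometric (F : (set T)^nat) (r : R) :
  (forall n, measurable (F n)) -> 0 <= r < 1 ->
  (forall n, mu (F n) <= (r ^+ n)%:E)%E ->
  \forall x \ae mu, \forall n \near \oo, ~ F n x.
Proof.
move=> mF /andP[r0 r1] muF.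
have : mu (lim_sup_set F) = 0%E.
  apply: lim_sup_set_cvg0 => //.
  apply: (@le_lt_trans _ _ (\sum_(0 <= n <oo) (r ^+ n)%:E)%E).
    by apply: lee_nneseries => [i _ _|n _]; [exact: measure_ge0|exact: muF].
  have -> : (\sum_(0 <= n <oo) (r ^+ n)%:E = (1 - r)^-1%:E)%E; last exact: ltey.
  apply/cvg_lim => //.
  apply: cvg_EFin; first by apply: nearW => n /=; rewrite sumEFin.
  have := @cvg_geometric_series R 1 r; rewrite ger0_norm// div1r => /(_ r1).
  congr (cvg_to _ _); congr (_ @ \oo); apply/funext => n /=.
  by rewrite sumEFin /series/=; apply: eq_bigr => i _; rewrite mul1r.
have mlim : measurable (lim_sup_set F).
  by apply: bigcap_measurable => // k _; exact: bigcup_measurable.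
move=> /(ae_probability0 mlim); apply: filterS => x nlim.
apply: contrapT => nF; apply: nlim => m _ /=.
apply: contrapT => nm; apply: nF; exists m => // n mn Fn; apply: nm.
by exists n.
Qed.

End probability_limits.

(** * A zero-one law for ergodic maps *)

Section ergodic_system.
Context d (T : measurableType d) (R : realType) (mu : probability T R).
Variable S : T -> T.
Hypothesis mS : measurable_fun [set: T] S.
Hypothesis muS : forall B, measurable B -> mu (S @^-1` B) = mu B.

Lemma measurable_preimage_shift (B : set T) :
  measurable B -> measurable (S @^-1` B).
Proof. by move=> mB; rewrite -[X in measurable X]setTI; exact: mS. Qed.

Lemma measurable_preimage_iter (B : set T) n :
  measurable B -> measurable (iter n S @^-1` B).
Proof.
elim: n B => [//|n IH] B mB.
exact: (IH _ (measurable_preimage_shift mB)).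
Qed.

Lemma measure_preimage_iter (B : set T) n :
  measurable B -> mu (iter n S @^-1` B) = mu B.
Proof.
elim: n B => [//|n IH] B mB.
by rewrite -(muS mB) -(IH _ (measurable_preimage_shift mB)).
Qed.

Definition ergodic_map := forall B, measurable B -> S @^-1` B = B ->
  mu B = 0%E \/ mu B = 1%E.

Hypothesis ergS : ergodic_map.

(** The preimages of [E] under the iterates of [S] increase and all have the
    measure of [E]; their union is invariant. *)
Lemma subinvariant_zero_one (E : set T) :
  measurable E -> E `<=` S @^-1` E -> mu E = 0%E \/ mu E = 1%E.
Proof.
move=> mE ES; pose F n := iter n S @^-1` E.
have mF n : measurable (F n) by exact: measurable_preimage_iter.
have ndF : nondecreasing_seq F.
  apply/nondecreasing_seqP => n; apply/subsetPset => x /= Fx.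
  exact: (ES _ Fx).
have mB : measurable (\bigcup_n F n) by exact: bigcup_measurable.
have -> : mu E = mu (\bigcup_n F n).
  have /cvg_lim <-// := @nondecreasing_cvg_mu _ _ _ mu F mF mB ndF.
  rewrite (_ : _ \o F = cst (mu E)) ?lim_cst//.
  by apply/funext => n /=; rewrite [LHS]measure_preimage_iter.
apply: ergS => //; apply/seteqP; split => x /= [n _ Fx].
  by exists n.+1 => //; rewrite /F /= -iterS iterSr.
by exists n => //; rewrite /F /= -iterSr /=; exact: (ES _ Fx).
Qed.

(** Read [G j n x] as: at time [n], an average exceeds a level that increases
    with [j] to some [c]. The first alternative says that the limsup of the
    averages is at least [c], the second that it is smaller. Shifting the point
    perturbs the averages, which is why the level may change from [j'] to
    [j]. *)
Lemma frequently_zero_one (G : nat -> nat -> set T) :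
  (forall j n, measurable (G j n)) ->
  (forall j, exists j', \forall n \near \oo,
    G j' n.+1 `<=` S @^-1` (G j n)) ->
  (\forall x \ae mu, forall j m, exists n, (m <= n)%N /\ G j n x) \/
  (\forall x \ae mu, exists j, \forall n \near \oo, ~ G j n x).
Proof.
move=> mG GS; pose E := \bigcap_j lim_sup_set (G j).
have mE : measurable E.
  apply: bigcap_measurable => // j _.
  by apply: bigcap_measurable => // k _; exact: bigcup_measurable.
have ES : E `<=` S @^-1` E.
  move=> x Ex j _ m _.
  have [j' [m' _ H]] := GS j.
  have [[//|n] /= mn Gn] := Ex j' I (maxn m m').+1 I.
  exists n => /=; first by rewrite (leq_trans (leq_maxl m m')).
  by apply: H Gn => /=; rewrite (leq_trans (leq_maxr m m')).
case: (subinvariant_zero_one mE ES) => [muE|muE].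
- right; move: (ae_probability0 mE muE); apply: filterS => x nE.
  apply: contrapT => nG; apply: nE => j _ m _ /=.
  apply: contrapT => nm; apply: nG; exists j, m => // n mn Gn; apply: nm.
  by exists n.
- left; move: (ae_probability1 mE muE); apply: filterS => x Ex j m.
  by have [n mn Gn] := Ex j I m I; exists n.
Qed.

(** * Frequency of visits *)

Definition visits (C : set T) n (x : T) : R := \sum_(k < n) \1_C (iter k S x).

Lemma visits0 C x : visits C 0 x = 0.
Proof. by rewrite /visits big_ord0. Qed.

Lemma visitsD C m n x :
  visits C (m + n) x = visits C m x + visits C n (iter m S x).
Proof.
rewrite /visits big_split_ord/=; congr (_ + _).
by apply: eq_bigr => i _; rewrite -iterD addnC.
Qed.

Lemma visitsS C n x : visits C n.+1 x = \1_C x + visits C n (S x).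
Proof. by rewrite -add1n visitsD {1}/visits big_ord1. Qed.

Lemma visits_ge0 C n x : 0 <= visits C n x.
Proof. by apply: sumr_ge0 => i _; rewrite indicE. Qed.

Lemma measurable_visits C n : measurable C ->
  measurable_fun [set: T] (visits C n).
Proof.
move=> mC; apply: measurable_sum => i.
have -> : (fun x => \1_C (iter i S x) : R) = \1_(iter i S @^-1` C).
  by apply/funext => x; rewrite !indicE.
by apply: measurable_indic; exact: measurable_preimage_iter.
Qed.

Lemma integral_visits C n : measurable C ->
  (\int[mu]_x (visits C n x)%:E = (n%:R * fine (mu C))%:E)%E.
Proof.
move=> mC.
have ind k : (fun x => \1_C (iter k S x) : R) = \1_(iter k S @^-1` C).
  by apply/funext => x; rewrite !indicE.
under eq_integral do rewrite /visits -sumEFin.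
rewrite (@ge0_integral_sum _ _ _ mu _ measurableT).
- rewrite (eq_bigr (fun=> (fine (mu C))%:E)) => [|k _].
    by rewrite sumEFin sumr_const card_ord mulr_natl.
  rewrite fineK ?fin_num_measure// -(measure_preimage_iter k mC).
  have := integral_indic mu measurableT (measurable_preimage_iter k mC).
  by rewrite setIT => <-; apply: eq_integral => x _; rewrite !indicE.
- move=> k; apply/measurable_EFinP; rewrite ind.
  by apply: measurable_indic; exact: measurable_preimage_iter.
- by move=> k x _; rewrite lee_fin indicE.
Qed.

Definition rarely_visits (C : set T) (b : R) (L : nat) : set T :=
  [set y | forall l, (1 <= l <= L)%N -> visits C l y < b * l%:R].

(** Cut the orbit greedily. From a point outside [rarely_visits C b L] some
    block of length at most [L] spends a proportion at least [b] of its time in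
    [C]: skip it. From a point inside, skip one step and pay for it. The last
    [L] steps are paid for as well. *)
Lemma visits_packing (C : set T) (b : R) (L : nat) (x : T) (n : nat) :
  0 <= b ->
  b * n%:R <= visits C n x + b * (visits (rarely_visits C b L) n x + (minn n L)%:R) :> R.
Proof.
set B := rarely_visits C b L => b0; have [k] := ubnP n; elim: k n x => // k IH n x.
rewrite ltnS => nk.
have [->|n0] := posnP n; first by rewrite !visits0 min0n mulr0 !add0r mulr0.
have [nL|Ln] := leqP n L.
  have := mulr_ge0 b0 (visits_ge0 B n x).
  by have := visits_ge0 C n x; lra.
have [Bx|/existsNP[l /not_implyP[/andP[l1 lL] /negP]]] := pselect (B x).
  case: n n0 nk Ln => // n _ nk Ln; rewrite !visitsS.
  have := IH n (S x) nk; rewrite (minn_idPr (_ : (L <= n)%N))//.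
  have -> : \1_B x = 1 :> R by rewrite indicE mem_set.
  rewrite -[n.+1%:R]natr1 => H.
  have : 0 <= \1_C x :> R by rewrite indicE.
  move: H; move: (visits C n (S x)) (visits B n (S x)) (\1_C x) (n%:R) (L%:R).
  by move=> v w i N l; nra.
rewrite -leNgt => Cl.
have ln : (l <= n)%N by rewrite (leq_trans lL)// ltnW.
rewrite -(subnKC ln) !visitsD.
have := IH (n - l)%N (iter l S x) _; rewrite (_ : (n - l < k)%N); last first.
  by rewrite (leq_trans _ nk)// ltn_subrL l1 n0.
move=> /(_ isT) H; rewrite natrD.
have := visits_ge0 B l x.
have : (minn (n - l) L)%:R <= L%:R :> R by rewrite ler_nat geq_minr.
by move: H Cl; nra.
Qed.

Lemma measurable_visits_ge C (c : R) n :
  measurable C -> measurable [set x | c <= visits C n x].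
Proof.
move=> mC; rewrite -[X in measurable X]setTI.
apply: (@measurable_fun_le _ _ _ setT (fun=> c)) => //.
exact: measurable_visits.
Qed.

Lemma rarely_visitsE C (b : R) L : rarely_visits C b L =
  [set x | forall n, (1 <= n <= L)%N -> ~ (b * n%:R <= visits C n x)].
Proof.
apply/seteqP; split => x Bx n nL; have := Bx n nL.
  by move=> H; apply/negP; rewrite -ltNge.
by move=> /negP; rewrite -ltNge.
Qed.

Lemma measurable_rarely_visits C (b : R) L :
  measurable C -> measurable (rarely_visits C b L).
Proof.
move=> mC; rewrite rarely_visitsE [X in measurable X](_ : _ =
  \bigcap_(n in [set n | (1 <= n <= L)%N]) ~` [set x | b * n%:R <= visits C n x])//.
apply: bigcap_measurableType => n _; apply: measurableC.
exact: measurable_visits_ge.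
Qed.

Lemma mean_visits_packing (C : set T) (b : R) (L n : nat) :
  measurable C -> 0 < b ->
  b * n%:R <= n%:R * fine (mu C) +
    b * (n%:R * fine (mu (rarely_visits C b L)) + L%:R).
Proof.
move=> mC b0; set B := rarely_visits C b L.
have mB : measurable B by exact: measurable_rarely_visits.
rewrite -lee_fin.
rewrite [leRHS](_ : _ = (\int[mu]_x (visits C n x)%:E +
  b%:E * (\int[mu]_x (visits B n x)%:E + L%:R%:E))%E); last first.
  by rewrite !integral_visits.
have mE D : measurable D ->
    measurable_fun [set: T] (fun x => (visits D n x)%:E).
  by move=> mD; apply/measurable_EFinP; exact: measurable_visits.
have v0 D x : (0 <= (visits D n x)%:E)%E by rewrite lee_fin visits_ge0.
have cst1 r : (\int[mu]_x r%:E = r%:E)%E.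
  by rewrite integral_cst// [X in (_ * X)%E]probability_setT mule1.
rewrite -[X in (X <= _)%E]cst1 -[in X in (_ + X)%E](cst1 L%:R).
rewrite -ge0_integralD//; last exact: mE.
rewrite -ge0_integralZl_EFin//; last 3 first.
- by move=> x _; rewrite adde_ge0.
- by apply: emeasurable_funD => //; exact: mE.
- exact: ltW.
rewrite -ge0_integralD//.
- apply: ge0_le_integral => //.
  + by move=> x _; rewrite lee_fin mulr_ge0// ltW.
  + apply: emeasurable_funD; first exact: mE.
    apply: emeasurable_funM => //.
    by apply: emeasurable_funD => //; exact: mE.
  + move=> x _; change ((b * n%:R)%:E <=
      (visits C n x + b * (visits B n x + L%:R))%:E)%E; rewrite lee_fin.
    apply: (le_trans (visits_packing C L x n (ltW b0))).
    by rewrite lerD2l (ler_wpM2l (ltW b0))// lerD2l ler_nat geq_minr.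
- exact: mE.
- by move=> x _; rewrite mule_ge0 ?adde_ge0// lee_fin ltW.
- apply: emeasurable_funM => //.
  by apply: emeasurable_funD => //; exact: mE.
Qed.

(** The upper half of Birkhoff's theorem for an indicator. If the conclusion
    failed, the zero-one law would make the frequency of visits exceed some
    [c] larger than the measure of [C] infinitely often almost surely; the
    points that wait longer than [L] for this then have small measure, and the
    averaged packing inequality bounds the measure of [C] below by almost
    [c]. *)
Lemma visits_upper (C : set T) (b : R) : measurable C -> 0 <= b ->
  (fine (mu C) < b) ->
  \forall x \ae mu, \forall n \near \oo, visits C n x < b * n%:R.
Proof.
move=> mC b0 muCb.
pose G j n := [set x | (b - j.+1%:R^-1) * n%:R <= visits C n x].
have mG j n : measurable (G j n) by exact: measurable_visits_ge.
have [|j|H|H] := @frequently_zero_one G.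
- exact: mG.
- exists j.+1.
  pose e : R := j.+1%:R^-1 - j.+2%:R^-1.
  have e0 : 0 < e by rewrite subr_gt0 ltf_pV2 ?posrE// ltr_nat.
  near=> n => x; rewrite /G /= visitsS -[n.+1%:R]natr1.
  (* the gap [n * e] absorbs the loss of at most one visit, by the first
     letter, and of at most one unit of time *)
  have n2 : 2 < n%:R * e by rewrite -ltr_pdivrMr//; near: n; exact: nbhs_infty_gtr.
  have : j.+2%:R^-1 <= 1 :> R by rewrite invf_le1// ler1n.
  have : \1_C x <= 1 :> R by rewrite indicE lern1 leq_b1.
  move: n2; rewrite /e.
  move: (j.+1%:R^-1) (j.+2%:R^-1) (n%:R) (\1_C x) (visits C n (S x)).
  by move=> u v N i w; nra.
- exfalso.
  have bC0 : 0 < b - fine (mu C) by rewrite subr_gt0.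
  have [j _ /(_ j (leqnn j)) /= Hj] := near_infty_natSinv_lt (PosNum bC0).
  pose c := b - j.+1%:R^-1.
  have cC : fine (mu C) < c by rewrite /c ltrBrDl -ltrBrDr.
  have muC0 : 0 <= fine (mu C) by rewrite fine_ge0.
  have c0 : 0 < c by rewrite (le_lt_trans _ cC).
  (* the factor 2 leaves half of the gap [c - mu C] for the contradiction *)
  pose e := (c - fine (mu C)) / (2 * c).
  have e0 : 0 < e by rewrite divr_gt0 ?mulr_gt0// subr_gt0.
  have H' : \forall x \ae mu, forall m, exists n, (m <= n)%N /\ G j n x.
    by apply: filterS H => x /(_ j).
  have [L [_ HL]] := late_probability_lt (mG j) H' 1 e0.
  have mB : measurable (rarely_visits C c L) by exact: measurable_rarely_visits.
  have Be : fine (mu (rarely_visits C c L)) < e.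
    by rewrite -lte_fin fineK ?fin_num_measure// rarely_visitsE.
  have [N _ /(_ N (leqnn N)) /= HN] :=
    nbhs_infty_gtr ((c * L%:R) / ((c - fine (mu C)) / 2)).
  have := mean_visits_packing L N mC c0.
  rewrite ltr_pdivrMr ?divr_gt0 ?subr_gt0// in HN.
  have : c * fine (mu (rarely_visits C c L)) <= (c - fine (mu C)) / 2.
    rewrite (le_trans (ler_wpM2l (ltW c0) (ltW Be)))// /e.
    rewrite [leLHS](_ : _ = (c - fine (mu C)) / 2)//.
    by field; rewrite gt_eqF.
  move=> H1 H2.
  have H3 : N%:R * (c * fine (mu (rarely_visits C c L))) <=
      N%:R * ((c - fine (mu C)) / 2).
    by rewrite ler_wpM2l.
  by move: HN H2 H3; lra.
apply: filterS H => x [j]; apply: filterS => n /negP; rewrite -ltNge.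
by move=> /lt_le_trans; apply; rewrite ler_wpM2r// gerBl invr_ge0.
Unshelve. all: by end_near. Qed.

End ergodic_system.

(** * Finitely valued functions on a probability space *)

Section total_probability.
Context d (T : measurableType d) (R : realType) (nu : probability T R).
Context (I : choiceType) (f : T -> I) (r : seq I).
Hypotheses (mf : forall i, measurable (f @^-1` [set i])) (r_uniq : uniq r).
Hypothesis fr : forall x, f x \in r.

Lemma total_probability (B : set T) : measurable B ->
  fine (nu B) = \sum_(i <- r) fine (nu (B `&` f @^-1` [set i])).
Proof.
move=> mB; have mBi i : measurable (B `&` f @^-1` [set i]) by exact: measurableI.
have mBs (t : seq I) : measurable (B `&` [set x | f x \in t]).
  apply: measurableI => //; elim: t => [|i t IH].
    by rewrite (_ : mkset _ = set0)//; apply/seteqP; split.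
  rewrite (_ : mkset _ = f @^-1` [set i] `|` [set x | f x \in t]).
    exact: measurableU.
  apply/seteqP; split => x /=; rewrite inE.
    by move=> /orP[/eqP ->|]; [left|right].
  by move=> [->|->]; rewrite ?eqxx ?orbT.
rewrite [in LHS](_ : B = B `&` [set x | f x \in r]); last first.
  by apply/seteqP; split => x /=; [move=> Bx; split|case].
elim: r r_uniq => [_|i t IH /= /andP[it ut]].
  by rewrite big_nil (_ : _ `&` _ = set0) ?measure0//; apply/seteqP; split => x [].
rewrite big_cons -IH// -fineD ?fin_num_measure// -measureU//.
  congr (fine (nu _)); apply/seteqP; split => x /=; rewrite inE.
    by move=> [Bx /orP[/eqP ->|]]; [left|right].
  by move=> [[Bx ->]|[Bx ->]]; rewrite ?eqxx ?orbT.
apply/seteqP; split => x //= [[_ fi] [_]]; rewrite fi.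
by move: it => /negP.
Qed.

Lemma finite_probability (P : pred I) :
  fine (nu [set x | P (f x)]) =
  \sum_(i <- r | P i) fine (nu (f @^-1` [set i])).
Proof.
rewrite total_probability; last first.
  rewrite (_ : mkset _ =
      \big[setU/set0]_(i <- [seq i <- r | P i]) (f @^-1` [set i])).
    by apply: bigsetU_measurable.
  rewrite -bigcup_seq; apply/seteqP; split => [x /= Px|x [i /=]].
    by exists (f x) => //=; rewrite mem_filter Px fr.
  by rewrite mem_filter => /andP[Pi _] ->.
rewrite [RHS]big_mkcond/=; apply: eq_bigr => i _.
have [Pi|/negP Pi] := boolP (P i).
  by congr (fine (nu _)); apply/seteqP; split => x /=; [case|move=> ->].
rewrite (_ : _ `&` _ = set0) ?measure0//.
by apply/seteqP; split => x //= [Pf fi]; apply: Pi; rewrite -fi.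
Qed.

Lemma measurable_finite_preimage (B : set I) : measurable (f @^-1` B).
Proof.
rewrite (_ : f @^-1` B =
    \big[setU/set0]_(i <- [seq i <- r | `[< B i >]]) (f @^-1` [set i])).
  exact: bigsetU_measurable.
rewrite -bigcup_seq; apply/seteqP; split => [x /= Bfx|x [i /=]].
  by exists (f x) => //=; rewrite mem_filter fr andbT; exact/asboolP.
rewrite mem_filter => /andP[/asboolP Bi _] fxi.
by rewrite /preimage /= fxi.
Qed.

Lemma finite_expectation (g : I -> R) :
  (\int[nu]_x (g (f x))%:E =
   (\sum_(i <- r) fine (nu (f @^-1` [set i])) * g i)%:E)%E.
Proof.
have setTE : [set: T] = \big[setU/set0]_(i <- r) (f @^-1` [set i]).
  by rewrite -bigcup_seq; apply/seteqP; split => // x _; exists (f x) => //; exact: fr.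
rewrite setTE integral_bigsetU_EFin//; last 2 first.
- by move=> i j _ _ [x [/= -> ->]].
- rewrite -setTE => _ B mB; rewrite setTI.
  exact: (measurable_finite_preimage ((EFin \o g) @^-1` B)).
rewrite -sumEFin; apply: eq_bigr => i _.
rewrite (eq_integral (cst (g i)%:E)) => [|x]; last by rewrite inE => /= ->.
by rewrite integral_cst// EFinM fineK ?fin_num_measure// muleC.
Qed.

End total_probability.

(** * Words and their probabilities *)

Section words.
Context (A : choiceType) (s : seq A).

Fixpoint words (n : nat) : seq (seq A) :=
  if n is m.+1 then [seq a :: w | a <- s, w <- words m] else [:: [::]].

Context (R : realType).
Implicit Types F : seq A -> R.

Lemma sum_words0 F : \sum_(w <- words 0) F w = F [::].
Proof. by rewrite big_seq1. Qed.

Lemma sum_words_cons n F :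
  \sum_(w <- words n.+1) F w = \sum_(a <- s) \sum_(w <- words n) F (a :: w).
Proof. by rewrite big_allpairs_dep. Qed.

Lemma sum_words_cat m n F : \sum_(w <- words (m + n)) F w =
  \sum_(u <- words m) \sum_(v <- words n) F (u ++ v).
Proof.
elim: m F => [|m IH] F; first by rewrite sum_words0.
rewrite addSn !sum_words_cons; apply: eq_bigr => a _; exact: IH.
Qed.

Lemma sum_words_rcons n F :
  \sum_(w <- words n.+1) F w = \sum_(w <- words n) \sum_(a <- s) F (rcons w a).
Proof.
rewrite -addn1 sum_words_cat; apply: eq_bigr => w _.
rewrite sum_words_cons; apply: eq_bigr => a _.
by rewrite sum_words0 cats1.
Qed.

Hypothesis s_all : forall a, a \in s.
Hypothesis s_uniq : uniq s.

Lemma mem_words n w : (w \in words n) = (size w == n).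
Proof.
elim: n w => [|n IH] w; first by rewrite inE; case: w.
case: w => [|a w].
  by apply/negbTE/allpairsP => -[[b v] /= []].
rewrite /= eqSS -IH; apply/allpairsP/idP => [[[b v] /= [_ ? [_ ->]]]//|wn].
by exists (a, w).
Qed.

Lemma words_uniq n : uniq (words n).
Proof.
elim: n => //= n IH; apply: allpairs_uniq => //.
by move=> [a u] [b v] _ _ /= [-> ->].
Qed.

Lemma eq_sum_words n F G : (forall w, size w = n -> F w = G w) ->
  \sum_(w <- words n) F w = \sum_(w <- words n) G w.
Proof.
move=> FG; rewrite !big_seq; apply: eq_bigr => w.
by rewrite mem_words => /eqP; exact: FG.
Qed.

Lemma ler_sum_words n F G : (forall w, size w = n -> F w <= G w) ->
  \sum_(w <- words n) F w <= \sum_(w <- words n) G w.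
Proof.
move=> FG; rewrite !big_seq; apply: ler_sum => w.
by rewrite mem_words => /eqP; exact: FG.
Qed.

Lemma size_words n : size (words n) = (size s ^ n)%N.
Proof. by elim: n => //= n IH; rewrite size_allpairs IH expnS. Qed.

End words.

Section process_words.
Context d (T : measurableType d) (R : realType) (mu : probability T R).
Variable S : T -> T.
Hypothesis mS : measurable_fun [set: T] S.
Hypothesis muS : forall B, measurable B -> mu (S @^-1` B) = mu B.
Context (A : choiceType) (s : seq A).
Hypothesis s_all : forall a, a \in s.
Hypothesis s_uniq : uniq s.
Variable letter : T -> A.
Hypothesis mletter : forall B : set A, measurable (letter @^-1` B).

Fixpoint word (n : nat) (x : T) : seq A :=
  if n is m.+1 then letter x :: word m (S x) else [::].

Lemma size_word n x : size (word n x) = n.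
Proof. by elim: n x => //= n IH x; rewrite IH. Qed.

Lemma wordD m n x : word (m + n) x = word m x ++ word n (iter m S x).
Proof.
elim: m x => //= m IH x; rewrite IH.
by rewrite -iterS iterSr.
Qed.

Lemma word_rcons n x : word n.+1 x = rcons (word n x) (letter (iter n S x)).
Proof. by rewrite -addn1 wordD cats1. Qed.

Lemma measurable_word n (D : set (seq A)) : measurable (word n @^-1` D).
Proof.
elim: n D => [|n IH] D.
  have [D0|D0] := pselect (D [::]).
    by rewrite (_ : _ @^-1` _ = setT)//; apply/seteqP; split.
  by rewrite (_ : _ @^-1` _ = set0)//; apply/seteqP; split.
rewrite (_ : _ @^-1` _ = \big[setU/set0]_(a <- s)
    (letter @^-1` [set a] `&` S @^-1` (word n @^-1` [set w | D (a :: w)]))).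
  apply: bigsetU_measurable => a _; apply: measurableI => //.
  exact: (measurable_preimage_shift mS).
rewrite -bigcup_seq; apply/seteqP; split => [x /= Dx|x [a _ /= [-> //]]].
by exists (letter x) => //; exact: s_all.
Qed.

Definition word_prob (w : seq A) : R :=
  fine (mu (word (size w) @^-1` [set w])).

Lemma word_prob_ge0 w : 0 <= word_prob w.
Proof. exact: fine_ge0. Qed.

Lemma word_prob_le1 w : word_prob w <= 1.
Proof.
rewrite -lee_fin fineK ?fin_num_measure//; last exact: measurable_word.
exact/probability_le1/measurable_word.
Qed.

Lemma word_prob_pred n (P : pred (seq A)) :
  fine (mu [set x | P (word n x)]) = \sum_(w <- words s n | P w) word_prob w.
Proof.
rewrite (@finite_probability _ _ _ mu _ (word n) (words s n)).
- rewrite big_seq_cond [RHS]big_seq_cond; apply: eq_bigr => w /andP[].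
  by rewrite mem_words// /word_prob => /eqP ->.
- by move=> w; exact: measurable_word.
- exact: words_uniq.
- by move=> x; rewrite mem_words// size_word.
Qed.

Lemma sum_word_prob n : \sum_(w <- words s n) word_prob w = 1.
Proof.
rewrite -(@word_prob_pred n predT) (_ : mkset _ = setT) ?probability_setT//.
by apply/seteqP; split.
Qed.

Lemma word_prob_nil : word_prob [::] = 1.
Proof. by rewrite -(sum_word_prob 0) big_seq1. Qed.

Lemma sum_word_prob_cons w : \sum_(a <- s) word_prob (a :: w) = word_prob w.
Proof.
have mw := measurable_word (size w) [set w].
rewrite [RHS]/word_prob -muS// (@total_probability _ _ _ mu _ letter s)//.
- apply: eq_bigr => a _; congr (fine (mu _)).
  by apply/seteqP; split => x /=; [case=> -> ->|case=> -> ->].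
- exact: (measurable_preimage_shift mS).
Qed.

Lemma sum_word_prob_rcons w :
  \sum_(a <- s) word_prob (rcons w a) = word_prob w.
Proof.
have mw := measurable_word (size w) [set w].
rewrite [RHS]/word_prob.
rewrite (@total_probability _ _ _ mu _ (letter \o iter (size w) S) s)//.
  apply: eq_bigr => a _; congr (fine (mu _)); rewrite size_rcons.
  apply/seteqP; split => x; rewrite /preimage/= -/(word (size w).+1 x) word_rcons.
    by move=> /rcons_inj[].
  by move=> [-> ->].
by move=> a; exact: (measurable_preimage_iter mS _ (mletter [set a])).
Qed.

Lemma word_prob_cons_le a w : word_prob (a :: w) <= word_prob w.
Proof.
rewrite -[leRHS]sum_word_prob_cons (big_rem a)//= lerDl sumr_ge0// => b _.
exact: word_prob_ge0.
Qed.

Lemma word_prob_rcons_le w a : word_prob (rcons w a) <= word_prob w.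
Proof.
rewrite -[leRHS]sum_word_prob_rcons (big_rem a)//= lerDl sumr_ge0// => b _.
exact: word_prob_ge0.
Qed.

(** Markov's inequality: the words [w] of length [n] with
    p(w) <= exp(- e n) U(w) have total probability at most exp(- e n), which is
    summable. *)
Lemma word_borel_cantelli (U : nat -> seq A -> R) (e : R) :
  (forall n w, 0 <= U n w) -> (forall n, \sum_(w <- words s n) U n w <= 1) ->
  0 < e ->
  \forall x \ae mu, \forall n \near \oo,
    U n (word n x) < expR (e * n%:R) * word_prob (word n x).
Proof.
move=> U0 U1 e0.
pose F n := [set x | expR (e * n%:R) * word_prob (word n x) <= U n (word n x)].
have mF n : measurable (F n).
  exact: (measurable_word n
    [set w | expR (e * n%:R) * word_prob w <= U n w]).
have muF n : (mu (F n) <= (expR (- e) ^+ n)%:E)%E.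
  rewrite -[leLHS]fineK ?fin_num_measure// lee_fin.
  rewrite (word_prob_pred n (fun w => expR (e * n%:R) * word_prob w <= U n w)).
  rewrite -expRM_natr mulNr expRN.
  rewrite -[leRHS]mul1r ler_pdivlMr ?expR_gt0//.
  apply: le_trans (U1 n); rewrite mulr_suml [leRHS](bigID (fun w =>
    expR (e * n%:R) * word_prob w <= U n w))/= -[leLHS]addr0 lerD//.
    by apply: ler_sum => w; rewrite mulrC.
  by apply: sumr_ge0.
have e1 : 0 <= expR (- e) < 1 by rewrite expR_ge0 expR_lt1 oppr_lt0.
have := borel_cantelli_geometric mF e1 muF.
by apply: filterS => x; apply: filterS => n /negP; rewrite -ltNge.
Qed.

End process_words.

(** * Packing words into blocks *)

Section word_weight.
Context (R : realType) (A : choiceType) (q : A -> R).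
Hypothesis q_gt0 : forall a, 0 < q a.

Definition word_weight (w : seq A) : R := \prod_(a <- w) q a.

Lemma word_weight_gt0 w : 0 < word_weight w.
Proof. by apply: prodr_gt0. Qed.

Lemma word_weight_cons a w : word_weight (a :: w) = q a * word_weight w.
Proof. by rewrite /word_weight big_cons. Qed.

Lemma word_weight_cat u v : word_weight (u ++ v) = word_weight u * word_weight v.
Proof. by rewrite /word_weight big_cat. Qed.

Lemma word_weight_rcons w a : word_weight (rcons w a) = word_weight w * q a.
Proof. by rewrite -cats1 word_weight_cat /word_weight big_seq1. Qed.

Hypothesis q_le1 : forall a, q a <= 1.

Lemma word_weight_le1 w : word_weight w <= 1.
Proof.
elim: w => [|a w IH]; first by rewrite /word_weight big_nil.
by rewrite word_weight_cons mulr_ile1// ltW// word_weight_gt0.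
Qed.

End word_weight.

Section packing_weight.
Context (R : realType) (A : choiceType) (s : seq A) (p : seq A -> R).
Hypothesis s_all : forall a, a \in s.
Hypothesis s_gt0 : (0 < size s)%N.
Hypothesis p_ge0 : forall w, 0 <= p w.
Hypothesis sum_p : forall n, \sum_(w <- words s n) p w = 1.
Variables (r : R) (M L : nat).
Hypothesis r01 : 0 <= r < 1.
Hypothesis M_gt0 : (0 < M)%N.
Hypothesis rM : r ^+ M / (1 - r) <= 2^-1.

(** Sum over all ways of cutting the word into single letters and blocks of
    length between [M] and [L], where a single letter has the weight of a
    uniform letter times 1/2, and a block of length [l] its probability times
    [r ^+ l]. The argument [k] is fuel for the recursion: the value is the
    intended one as soon as [k] is at least the length of the word. *)
Fixpoint packing_weight (k : nat) (w : seq A) : R :=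
  match k, w with
  | _, [::] => 1
  | 0, _ => 0
  | k.+1, _ :: w' => (2 * (size s)%:R)^-1 * packing_weight k w' +
      \sum_(M <= l < L.+1 | (l <= size w)%N)
        r ^+ l * p (take l w) * packing_weight k (drop l w)
  end.

Lemma packing_weight_ge0 k w : 0 <= packing_weight k w.
Proof.
have /andP[r0 _] := r01.
elim: k w => [|k IH] [|a w] //=; rewrite addr_ge0 ?mulr_ge0 ?invr_ge0 ?mulr_ge0//.
by apply: sumr_ge0 => l _; rewrite !mulr_ge0// exprn_ge0.
Qed.

(** Induction on the first piece: a single letter contributes 1/2, and a first
    block at most the sum of [r ^+ l] over [l >= M], which is at most 1/2 by
    the choice of [M]. *)
Lemma sum_packing_weight k n : \sum_(w <- words s n) packing_weight k w <= 1.
Proof.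
have /andP[r0 _] := r01.
elim: k n => [|k IH] [|n]; rewrite ?sum_words0//.
  by rewrite sum_words_cons big1// => a _; rewrite big1.
have -> : \sum_(w <- words s n.+1) packing_weight k.+1 w =
    \sum_(a <- s) \sum_(w <- words s n)
      (2 * (size s)%:R)^-1 * packing_weight k w +
    \sum_(w <- words s n.+1) \sum_(M <= l < L.+1 | (l <= size w)%N)
      r ^+ l * p (take l w) * packing_weight k (drop l w).
  rewrite !sum_words_cons -big_split/=; apply: eq_bigr => a _.
  by rewrite -big_split.
have N0 : (size s)%:R != 0 :> R by rewrite pnatr_eq0 -lt0n.
rewrite [leRHS](_ : 1 = 2^-1 + 2^-1); last by field.
apply: lerD.
  rewrite big_const_seq count_predT iter_addr_0 -mulr_sumr -[_ *+ size s]mulr_natl.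
  rewrite [leLHS](_ : _ = 2^-1 * \sum_(w <- words s n) packing_weight k w).
    by rewrite ler_piMr ?IH// invr_ge0.
  by field.
apply: le_trans rM; apply: le_trans (geometric_block_le M L.+1 r01).
rewrite (eq_sum_words s_all (G := fun w => \sum_(M <= l < L.+1)
    if (l <= n.+1)%N then r ^+ l * p (take l w) * packing_weight k (drop l w)
    else 0)); last by move=> w wn; rewrite big_mkcond/= wn.
rewrite exchange_big; apply: ler_sum => l _.
have [ln|_] := leqP l n.+1; last by rewrite big1// exprn_ge0.
rewrite -(subnKC ln) sum_words_cat.
rewrite (eq_sum_words s_all (G := fun u => r ^+ l * p u *
    \sum_(v <- words s (n.+1 - l)) packing_weight k v)).
  rewrite -mulr_suml -mulr_sumr sum_p mulr1.
  by rewrite ler_piMr ?IH ?exprn_ge0.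
move=> u ul; rewrite mulr_sumr; apply: eq_bigr => v _.
by rewrite take_size_cat// drop_size_cat.
Qed.

Lemma packing_weight_letter k a w :
  (2 * (size s)%:R)^-1 * packing_weight k w <= packing_weight k.+1 (a :: w).
Proof.
rewrite /= lerDl sumr_ge0// => l _.
have /andP[r0 _] := r01.
by rewrite !mulr_ge0 ?exprn_ge0 ?packing_weight_ge0.
Qed.

Lemma packing_weight_block k l w : (M <= l <= L)%N -> (l <= size w)%N ->
  r ^+ l * p (take l w) * packing_weight k (drop l w) <= packing_weight k.+1 w.
Proof.
move=> /andP[Ml lL] lw; have /andP[r0 _] := r01.
case: w lw => [|a w] lw; first by have := leq_trans M_gt0 (leq_trans Ml lw).
rewrite [leRHS]/= (big_rem l)/=; last by rewrite mem_index_iota Ml.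
rewrite lw addrCA lerDl addr_ge0//.
  by rewrite mulr_ge0 ?packing_weight_ge0// invr_ge0 mulr_ge0.
rewrite sumr_ge0// => i _.
by rewrite !mulr_ge0 ?exprn_ge0 ?packing_weight_ge0.
Qed.

End packing_weight.

Section frequent_blocks.
Context d (T : measurableType d) (R : realType) (mu : probability T R).
Variable S : T -> T.
Hypothesis mS : measurable_fun [set: T] S.
Hypothesis muS : forall B, measurable B -> mu (S @^-1` B) = mu B.
Hypothesis ergS : ergodic_map mu S.
Context (A : choiceType) (s : seq A).
Hypothesis s_all : forall a, a \in s.
Hypothesis s_uniq : uniq s.
Variable letter : T -> A.
Hypothesis mletter : forall B : set A, measurable (letter @^-1` B).
Variable q : A -> R.
Hypothesis q_gt0 : forall a, 0 < q a.
Hypothesis q_le1 : forall a, q a <= 1.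

Let p := word_prob mu S letter.
Let wd := word S letter.

Definition likely (b : R) (n : nat) : set T :=
  [set x | expR (b * n%:R) * word_weight q (wd n x) <= p (wd n x)].

Lemma measurable_likely b n : measurable (likely b n).
Proof.
exact: (measurable_word mS s_all mletter n
  [set w | expR (b * n%:R) * word_weight q w <= p w]).
Qed.

Definition unlikely_between (b : R) (M L : nat) : set T :=
  [set x | forall l, (M <= l <= L)%N -> ~ likely b l x].

Lemma measurable_unlikely_between b M L : measurable (unlikely_between b M L).
Proof.
rewrite (_ : unlikely_between _ _ _ =
  \bigcap_(l in [set l | (M <= l <= L)%N]) ~` likely b l)//.
apply: bigcap_measurableType => l _; apply: measurableC.
exact: measurable_likely.
Qed.

Lemma size_alphabet_gt0 : (0 < size s)%N.
Proof. by have := s_all (letter point); case: s. Qed.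

(** Greedy cutting, as in [visits_packing]: at a point of [likely b l] with
    [M <= l <= L] cut off the block, which costs only the factor exp(- e l);
    otherwise, and in the last [L] positions, cut off one letter, whose weight
    1/(2N), for N letters, is at least exp(b - e - K). *)
Lemma packing_weight_lower (b e K : R) (M L k n : nat) (x : T) :
  let B := unlikely_between b M L in
  0 <= e -> 0 <= K -> expR (b - e - K) <= (2 * (size s)%:R)^-1 ->
  expR (- e) ^+ M / (1 - expR (- e)) <= 2^-1 ->
  0 <= expR (- e) < 1 -> (0 < M)%N -> (n <= k)%N ->
  expR ((b - e) * n%:R - K * (visits _ S B n x + (minn n L)%:R)) *
    word_weight q (wd n x) <= packing_weight s p (expR (- e)) M L k (wd n x).
Proof.
move=> B e0 K0 HK rM r01 M0.
elim: k n x => [|k IH] [|n] x nk.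
- by rewrite mulr0 min0n visits0 addr0 mulr0 subr0 expR0 /word_weight big_nil mulr1.
- by [].
- by rewrite mulr0 min0n visits0 addr0 mulr0 subr0 expR0 /word_weight big_nil mulr1.
have p0 w : 0 <= p w by exact: word_prob_ge0.
have one_letter : 1 + visits R S B n (S x) + (minn n L)%:R <=
      visits R S B n.+1 x + (minn n.+1 L)%:R ->
    expR ((b - e) * n.+1%:R - K * (visits R S B n.+1 x + (minn n.+1 L)%:R)) *
    word_weight q (wd n.+1 x) <= packing_weight s p (expR (- e)) M L k.+1 (wd n.+1 x).
  move=> cost.
  apply: (le_trans _ (packing_weight_letter s p0 M L r01 k (letter x) _)).
  apply: (le_trans _ (ler_pM (expR_ge0 _) _ HK (IH n (S x) nk))); last first.
    by rewrite mulr_ge0 ?expR_ge0// ltW// word_weight_gt0.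
  rewrite mulrA -expRD word_weight_cons.
  apply: ler_pM; rewrite ?expR_ge0// ?mulr_ge0// ?(ltW (word_weight_gt0 q_gt0 _))//.
  - exact: ltW.
  - rewrite ler_expR.
    have := ler_wpM2l K0 cost.
    rewrite -[n.+1%:R]natr1.
    move: (visits R S B n (S x)) (visits R S B n.+1 x) => v1 v2.
    move: (minn n L)%:R (minn n.+1 L)%:R n%:R => l1 l2 N.
    by lra.
  - by rewrite ler_piMl// ltW// word_weight_gt0.
have [Bx|/existsNP[l /not_implyP[/andP[Ml lL] /contrapT lik]]] := pselect (B x).
  apply: one_letter; rewrite visitsS.
  have -> : \1_B x = 1 :> R by rewrite indicE mem_set.
  by rewrite lerD2l ler_nat; lia.
have [nL|] := boolP (n.+1 <= L)%N; last rewrite -ltnNge => Ln.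
  apply: one_letter; rewrite visitsS.
  have i0 : 0 <= \1_B x :> R by rewrite indicE.
  rewrite -addrA addrC -addrA lerD//.
    by rewrite lerDr.
  by rewrite natr1 ler_nat; lia.
have ln : (l <= n.+1)%N by rewrite (leq_trans lL)// ltnW.
have l0 : (0 < l)%N by exact: leq_trans Ml.
have := @packing_weight_block _ _ s p p0 _ M L r01 M0 k l (wd n.+1 x).
rewrite Ml lL size_word => /(_ isT ln).
apply: le_trans.
rewrite -(subnKC ln); set m := (n.+1 - l)%N.
have mk : (m <= k)%N by rewrite /m; lia.
rewrite /wd wordD take_size_cat ?size_word// drop_size_cat ?size_word//.
rewrite -/wd word_weight_cat.
have := IH m (iter l S x) mk; rewrite visitsD => IHm.
apply: (le_trans _ (ler_pM _ _ (ler_wpM2l (exprn_ge0 l (expR_ge0 (- e))) lik) IHm));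
  rewrite ?mulr_ge0 ?exprn_ge0 ?expR_ge0 ?(ltW (word_weight_gt0 q_gt0 _))//.
set E := (b - e) * m%:R - _.
rewrite -expRM_natr [leRHS](_ : _ = expR (- e * l%:R + b * l%:R + E) *
    (word_weight q (wd l x) * word_weight q (wd m (iter l S x)))); last first.
  by rewrite !expRD; ring.
rewrite /E {E}.
rewrite ler_wpM2r ?mulr_ge0 ?(ltW (word_weight_gt0 q_gt0 _))// ler_expR.
have v0 := visits_ge0 R S B l x.
have mL : (minn m L)%:R <= (minn (l + m) L)%:R :> R by rewrite ler_nat /m; lia.
rewrite natrD; move: v0 mL.
move: (visits R S B l x) (visits R S B m (iter l S x)) => v1 v2.
move: (minn m L)%:R (minn (l + m) L)%:R l%:R m%:R => l1 l2 N1 N2.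
by nra.
Qed.

(** The heart of the proof: for the log-likelihood ratio per letter, a lower
    bound on the limsup is a lower bound on the liminf. *)
Lemma frequently_likely_eventually (c : R) :
  (\forall x \ae mu, forall j m, exists n, (m <= n)%N /\
     likely (c - j.+1%:R^-1) n x) ->
  forall e : R, 0 < e -> \forall x \ae mu, \forall n \near \oo, likely (c - e) n x.
Proof.
move=> Hfreq e0 e0_gt0; pose e : R := e0 / 4.
have e_gt0 : 0 < e by rewrite divr_gt0.
have [j _ /(_ j (leqnn j)) /= Hj] := near_infty_natSinv_lt (PosNum e_gt0).
pose u : R := j.+1%:R^-1; pose b := c - u.
have {}Hj : u < e by [].
have r01 : 0 <= expR (- e) < 1 by rewrite expR_ge0 expR_lt1 oppr_lt0.
have half_gt0 : 0 < 2^-1 :> R by rewrite invr_gt0.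
(* blocks at least [M] long, so that the weights [r ^+ l] sum to at most 1/2 *)
have [M [M0 rM]] := geometric_tail_small r01 half_gt0.
have N1 : 1 <= (size s)%:R :> R by rewrite ler1n size_alphabet_gt0.
(* the cost of a single letter, see [packing_weight_lower] *)
pose K : R := `|b - e| + ln (2 * (size s)%:R).
have lnN : 0 <= ln (2 * (size s)%:R) :> R.
  by apply: ln_ge0; lra.
have K0 : 0 <= K by rewrite addr_ge0.
have HK : expR (b - e - K) <= (2 * (size s)%:R)^-1.
  rewrite -[leRHS](lnK (_ : _ \in Num.pos)); last first.
    by rewrite qualifE/= invr_gt0; lra.
  rewrite ler_expR lnV; last by rewrite qualifE/=; lra.
  by have := ler_norm (b - e); rewrite /K; lra.
(* a proportion [h] of single letters costs at most exp(e) per letter *)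
pose h : R := e / (K + 1).
have h0 : 0 < h by rewrite divr_gt0// ltr_wpDl.
have Kh : K * h <= e.
  rewrite /h mulrCA ler_piMr ?(ltW e_gt0)// ler_pdivrMr ?mul1r ?lerDl//.
  by rewrite ltr_wpDl.
have freq : \forall x \ae mu, forall m, exists n, (m <= n)%N /\ likely b n x.
  by apply: filterS Hfreq => x /(_ j).
have [L [_ muB]] := late_probability_lt (measurable_likely b) freq M h0.
have mB := measurable_unlikely_between b M L.
have few : \forall x \ae mu, \forall n \near \oo,
    visits R S (unlikely_between b M L) n x < h * n%:R.
  apply: (visits_upper mS muS ergS) => //; first exact: ltW.
  by rewrite -lte_fin fineK ?fin_num_measure.
have p0 w : 0 <= p w by exact: word_prob_ge0.
have sp n : \sum_(w <- words s n) p w = 1 by exact: sum_word_prob.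
have bc := @word_borel_cantelli _ _ _ mu _ mS _ _ s_all s_uniq _ mletter
  (fun n => packing_weight s p (expR (- e)) M L n) e
  (fun n => packing_weight_ge0 s p0 M L r01 n)
  (fun n => sum_packing_weight s_all size_alphabet_gt0 sp L r01 rM n n)
  e_gt0.
near=> x; near=> n.
have Hfew : visits R S (unlikely_between b M L) n x < h * n%:R.
  by near: n; near: x.
have Hbc : packing_weight s p (expR (- e)) M L n (wd n x) <
    expR (e * n%:R) * p (wd n x).
  by near: n; near: x.
have nbig : K * L%:R / (e - u) < n%:R by near: n; exact: nbhs_infty_gtr.
have low := @packing_weight_lower b e K M L n n x (ltW e_gt0) K0 HK rM r01 M0 (leqnn n).
move: (le_trans low (ltW Hbc)).
rewrite /likely/= -ler_pdivrMl ?expR_gt0// -expRN mulrA -expRD.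
apply: le_trans; rewrite ler_wpM2r ?(ltW (word_weight_gt0 q_gt0 _))// ler_expR.
rewrite ltr_pdivrMr ?subr_gt0// in nbig.
have Kv : K * visits R S (unlikely_between b M L) n x <= e * n%:R.
  rewrite (le_trans (ler_wpM2l K0 (ltW Hfew)))// mulrA.
  by rewrite ler_wpM2r.
have Km : K * (minn n L)%:R <= K * L%:R.
  by rewrite ler_wpM2l// ler_nat geq_minr.
have -> : e0 = 4 * e by rewrite /e; field.
move: nbig Kv Km; rewrite /b [K * (_ + _)]mulrDr.
move: (K * _) (K * _) (K * _) (n%:R) => k1 k2 k3 N.
by nra.
Unshelve. all: by end_near. Qed.

End frequent_blocks.

(** * Monotonicity of the entropy increments *)

Section entropy.
Context d (T : measurableType d) (R : realType) (mu : probability T R).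
Variable S : T -> T.
Hypothesis mS : measurable_fun [set: T] S.
Hypothesis muS : forall B, measurable B -> mu (S @^-1` B) = mu B.
Context (A : choiceType) (s : seq A).
Hypothesis s_all : forall a, a \in s.
Hypothesis s_uniq : uniq s.
Variable letter : T -> A.
Hypothesis mletter : forall B : set A, measurable (letter @^-1` B).
Variable q : A -> R.
Hypothesis q_gt0 : forall a, 0 < q a.
Hypothesis q_le1 : forall a, q a <= 1.

Let p := word_prob mu S letter.
Let ww := word_weight q.
Let ww_gt0 w : 0 < ww w. Proof. exact: word_weight_gt0. Qed.
Let p_ge0 w : 0 <= p w. Proof. exact: word_prob_ge0. Qed.

Definition log_ratio (w : seq A) : R := ln (p w / ww w).

Definition block_entropy (n : nat) : R :=
  \sum_(w <- words s n) p w * log_ratio w.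

Definition entropy_step (n : nat) : R :=
  \sum_(w <- words s n) \sum_(a <- s)
    p (rcons w a) * (log_ratio (rcons w a) - log_ratio w).

Lemma block_entropyS n : block_entropy n.+1 = block_entropy n + entropy_step n.
Proof.
rewrite /block_entropy /entropy_step sum_words_rcons -big_split/=.
apply: eq_bigr => w _.
have pw : p w = \sum_(a <- s) p (rcons w a) by rewrite sum_word_prob_rcons.
rewrite {1}pw mulr_suml -big_split/=.
by apply: eq_bigr => a _; ring.
Qed.

Lemma block_entropy0 : block_entropy 0 = 0.
Proof.
rewrite /block_entropy sum_words0 /log_ratio /p (word_prob_nil mu mS s_all s_uniq mletter).
by rewrite /ww /word_weight big_nil divr1 ln1 mulr0.
Qed.

Lemma log_ratioB w a : 0 < p (rcons w a) ->
  log_ratio (rcons w a) - log_ratio w = ln (p (rcons w a)) - ln (p w) - ln (q a).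
Proof.
move=> pwa; have pw : 0 < p w.
  by rewrite (lt_le_trans pwa)//; exact: word_prob_rcons_le.
rewrite /log_ratio /ww word_weight_rcons !ln_div ?posrE ?mulr_gt0 ?ww_gt0//.
rewrite lnM ?posrE ?ww_gt0// -/ww; ring.
Qed.

(** Conditioning on one more letter of the past increases the conditional
    relative entropy. Both sides are averages over words b w a, the left one by
    stationarity; their difference is the mean of
    log (p(bw) p(wa) / (p(w) p(bwa))), and log u <= u - 1 bounds it by
    1 - 1 = 0. *)
Lemma entropy_step_le n : entropy_step n <= entropy_step n.+1.
Proof.
have sum_rcons w := sum_word_prob_rcons mu mS s_all s_uniq mletter w.
have sum_cons w := sum_word_prob_cons mS muS s_all s_uniq mletter w.
rewrite /entropy_step sum_words_cons.
have -> : \sum_(w <- words s n) \sum_(a <- s)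
    p (rcons w a) * (log_ratio (rcons w a) - log_ratio w) =
  \sum_(b <- s) \sum_(w <- words s n) \sum_(a <- s)
    p (b :: rcons w a) * (log_ratio (rcons w a) - log_ratio w).
  rewrite [RHS]exchange_big; apply: eq_bigr => w _ /=.
  rewrite [RHS]exchange_big; apply: eq_bigr => a _ /=.
  by rewrite -mulr_suml sum_cons.
rewrite -subr_le0 -sumrB.
apply: (@le_trans _ _ (\sum_(b <- s) \sum_(w <- words s n) \sum_(a <- s)
   (p (b :: w) * p (rcons w a) / p w - p (b :: rcons w a)))).
  apply: ler_sum => b _; rewrite -sumrB; apply: ler_sum => w _.
  rewrite -sumrB; apply: ler_sum => a _.
  have [t0|t0] := ltP 0 (p (b :: rcons w a)); last first.
    have -> : p (b :: rcons w a) = 0 by apply/eqP; rewrite eq_le t0 p_ge0.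
    by rewrite rcons_cons !mul0r subrr subr0 !mulr_ge0 ?invr_ge0.
  have pwa : 0 < p (rcons w a).
    by rewrite (lt_le_trans t0)//; exact: word_prob_cons_le.
  have pbw : 0 < p (b :: w).
    by rewrite (lt_le_trans t0)// -rcons_cons; exact: word_prob_rcons_le.
  have pw : 0 < p w by rewrite (lt_le_trans pbw)//; exact: word_prob_cons_le.
  rewrite !log_ratioB// rcons_cons.
  rewrite -mulrBr.
  set t := p (b :: rcons w a).
  rewrite (_ : _ - _ - _ - _ = ln (p (b :: w) * p (rcons w a) / p w / t)); last first.
    rewrite !ln_div ?posrE ?divr_gt0 ?mulr_gt0// lnM ?posrE//; ring.
  rewrite (le_trans (ler_wpM2l (ltW t0) (ln_le_subr1 _)))//.
    by rewrite !divr_gt0 ?mulr_gt0.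
  by rewrite mulrBr mulr1 lerB// mulrCA divff ?mulr1// gt_eqF.
rewrite (eq_bigr (fun b => \sum_(w <- words s n) p (b :: w) -
    \sum_(w <- words s n) p (b :: w))); last first.
  move=> b _; rewrite -sumrB; apply: eq_bigr => w _.
  rewrite sumrB; congr (_ - _).
    rewrite -mulr_suml -mulr_sumr sum_rcons -/p.
    have [pw0|pw0] := eqVneq (p w) 0; last by rewrite mulfK.
    rewrite pw0 mulr0 mul0r; apply/esym/eqP; rewrite eq_le p_ge0 andbT -pw0.
    exact: word_prob_cons_le.
  exact: (sum_rcons (b :: w)).
by rewrite big1// => b _; rewrite subrr.
Qed.

Variable q0 : R.
Hypothesis q0_gt0 : 0 < q0.
Hypothesis q0_le : forall a, q0 <= q a.

Lemma entropy_step_ub n : entropy_step n <= - ln q0.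
Proof.
rewrite /entropy_step -[leRHS]mulr1 -(sum_word_prob mu mS s_all s_uniq mletter n.+1).
rewrite sum_words_rcons mulr_sumr; apply: ler_sum => w _.
rewrite mulr_sumr; apply: ler_sum => a _.
have [t0|t0] := ltP 0 (p (rcons w a)); last first.
  have -> : word_prob mu S letter (rcons w a) = 0.
    by apply/eqP; rewrite eq_le t0 p_ge0.
  have -> : p (rcons w a) = 0 by apply/eqP; rewrite eq_le t0 p_ge0.
  by rewrite mul0r mulr0.
rewrite log_ratioB// mulrC ler_wpM2r//.
have pw : p (rcons w a) <= p w by exact: word_prob_rcons_le.
have lnp : ln (p (rcons w a)) <= ln (p w).
  by rewrite ler_ln ?posrE// (lt_le_trans t0).
have lnq : ln q0 <= ln (q a) by rewrite ler_ln ?posrE.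
by lra.
Qed.

Lemma entropy_step_homo m n : (m <= n)%N -> entropy_step m <= entropy_step n.
Proof. by move: m n; apply/nondecreasing_seqP => n; exact: entropy_step_le. Qed.

Lemma entropy_step_cvg : exists h : R,
  entropy_step @ \oo --> h /\ forall n, entropy_step n <= h.
Proof.
have ub : has_ubound (range entropy_step).
  by exists (- ln q0) => _ [n _ <-]; exact: entropy_step_ub.
exists (sup (range entropy_step)); split.
  by apply: nondecreasing_cvgn => // m n; exact: entropy_step_homo.
by move=> n; apply: ub_le_sup => //; exists n.
Qed.

Lemma block_entropy_ub (h : R) n : (forall n, entropy_step n <= h) ->
  block_entropy n <= h * n%:R.
Proof.
move=> hub; elim: n => [|n IH]; first by rewrite block_entropy0 mulr0.
by rewrite block_entropyS -natr1 mulrDr mulr1 lerD.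
Qed.

Lemma block_entropy_lb m n :
  block_entropy m + entropy_step m * n%:R <= block_entropy (m + n).
Proof.
elim: n => [|n IH]; first by rewrite mulr0 addr0 addn0.
rewrite addnS block_entropyS -natr1 mulrDr mulr1 addrA lerD//.
by apply: entropy_step_homo; exact: leq_addr.
Qed.

(** * The Shannon-McMillan-Breiman theorem *)

Hypothesis ergS : ergodic_map mu S.

Let wd := word S letter.
Let lik := likely mu S letter q.

Lemma likely_antitone b c n : b <= c -> lik c n `<=` lik b n.
Proof.
move=> bc x; rewrite /lik /likely /=; apply: le_trans.
by rewrite ler_wpM2r ?(ltW (ww_gt0 _))// ler_expR ler_wpM2r.
Qed.

(** Dropping the first letter does not decrease p, and changes q by a factor at
    most [q0^-1], which a gap between the levels absorbs. *)
Lemma likely_shift b c : b < c ->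
  \forall n \near \oo, lik c n.+1 `<=` S @^-1` (lik b n).
Proof.
move=> bc; near=> n => x; rewrite /lik /likely /preimage /= -/(wd n (S x)).
set w := wd n (S x); set a := letter x.
move=> /le_trans/(_ (word_prob_cons_le mS muS s_all s_uniq mletter a w)).
apply: le_trans; rewrite word_weight_cons mulrA -/ww.
rewrite ler_wpM2r ?(ltW (ww_gt0 _))//.
apply: (@le_trans _ _ (expR (c * n.+1%:R) * q0)); last first.
  by rewrite ler_wpM2l// expR_ge0.
rewrite -(lnK (_ : q0 \in Num.pos))// -expRD ler_expR -[n.+1%:R]natr1.
have : (- c - ln q0) / (c - b) < n%:R by near: n; exact: nbhs_infty_gtr.
rewrite ltr_pdivrMr ?subr_gt0//.
by move: (n%:R) (ln q0) => N l; nra.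
Unshelve. all: by end_near. Qed.

Lemma likely_dichotomy c :
  (forall e : R, 0 < e -> \forall x \ae mu, \forall n \near \oo, lik (c - e) n x) \/
  (\forall x \ae mu, \forall n \near \oo, ~ lik c n x).
Proof.
pose G j n := lik (c - j.+1%:R^-1) n.
have mG j n : measurable (G j n) by exact: measurable_likely.
have [j|freq|rare] := frequently_zero_one mS muS ergS mG.
- exists j.+1; apply: likely_shift.
  by rewrite ltrD2l ltrN2 ltf_pV2 ?posrE// ltr_nat.
- left; exact: (frequently_likely_eventually mS muS ergS s_all s_uniq mletter
    q_gt0 q_le1 freq).
- right; apply: filterS rare => x [j]; apply: filterS => n; apply: contra_not.
  by apply: likely_antitone; rewrite gerBl invr_ge0.
Qed.

Lemma likely_prob c n : fine (mu (lik c n)) =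
  \sum_(w <- words s n | expR (c * n%:R) * ww w <= p w) p w.
Proof.
exact: (word_prob_pred mu mS s_all s_uniq mletter n
  (fun w => expR (c * n%:R) * ww w <= p w)).
Qed.

Lemma log_ratio_le w : 0 < p w -> log_ratio w <= - ln q0 * (size w)%:R.
Proof.
move=> pw; have : ln (p w) <= 0.
  by rewrite -ler_expR lnK ?posrE// expR0; exact: word_prob_le1.
suff : ln q0 * (size w)%:R <= ln (ww w).
  by rewrite /log_ratio ln_div ?posrE//; lra.
elim: w {pw} => [|a w IH]; first by rewrite mulr0 /ww /word_weight big_nil ln1.
rewrite /ww word_weight_cons lnM ?posrE ?ww_gt0// -natr1 mulrDr mulr1 addrC.
by rewrite lerD// ler_ln ?posrE.
Qed.

(** On the words with p < exp(c n) q the log-ratio is less than [c * n]; on the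
    others it is at most [- ln q0 * n]. *)
Lemma block_entropy_rare c n :
  block_entropy n <=
  c * n%:R + (- ln q0 - c) * n%:R * fine (mu (lik c n)).
Proof.
rewrite likely_prob mulr_sumr big_mkcond/=.
have sp : \sum_(w <- words s n) p w = 1 by exact: sum_word_prob.
rewrite [X in X + _](_ : _ = \sum_(w <- words s n) c * n%:R * p w); last first.
  by rewrite -mulr_sumr sp mulr1.
rewrite -big_split/=; apply: ler_sum_words => // w wn; rewrite -/p.
have [t0|t0] := ltP 0 (p w); last first.
  have -> : p w = 0 by apply/eqP; rewrite eq_le t0 p_ge0.
  by rewrite mul0r !mulr0 if_same addr0.
case: ifPn => [_|nlik]; rewrite ?addr0.
  have := ler_wpM2l (ltW t0) (log_ratio_le t0); rewrite wn.
  by move: (log_ratio w) (p w) (ln q0) n%:R => l P l0 N; nra.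
rewrite mulrC ler_wpM2r// -ler_expR lnK ?posrE ?divr_gt0//.
by rewrite ler_pdivrMr// ltW// ltNge.
Qed.

(** On the words with p >= exp(c n) q the log-ratio is at least [c * n]. On the
    others it is at least [ln p], whose contribution is controlled by comparing
    p with the uniform distribution on words: with N letters,
    - p log p <= p n log N + N^(-n). *)
Lemma block_entropy_likely c n :
  c * n%:R - (c + ln (size s)%:R) * n%:R * fine (mu (~` lik c n)) - 1
    <= block_entropy n.
Proof.
have s_gt0 : (0 < size s)%N by exact: size_alphabet_gt0 letter.
have N0 : 0 < (size s)%:R :> R by rewrite ltr0n.
have -> : fine (mu (~` lik c n)) =
    \sum_(w <- words s n | ~~ (expR (c * n%:R) * ww w <= p w)) p w.
  rewrite -(word_prob_pred mu mS s_all s_uniq mletter n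
    (fun w => ~~ (expR (c * n%:R) * ww w <= p w))).
  by congr (fine (mu _)); apply/seteqP; split => x /= /negP.
have one : 1 = \sum_(w <- words s n) (size s)%:R ^- n :> R.
  rewrite big_const_seq count_predT iter_addr_0 size_words.
  by rewrite -[_ *+ (_ ^ _)]mulr_natr natrX mulVf// expf_neq0// gt_eqF.
have sp : \sum_(w <- words s n) p w = 1 by exact: sum_word_prob.
rewrite [X in X - _ - _](_ : _ = \sum_(w <- words s n) c * n%:R * p w); last first.
  by rewrite -mulr_sumr sp mulr1.
rewrite [X in _ - X <= _]one mulr_sumr [X in _ - X - _]big_mkcond/= -!sumrB.
apply: ler_sum_words => // w wn; rewrite -/p.
have Nn0 : 0 < (size s)%:R ^+ n :> R by rewrite exprn_gt0.
have [t0|t0] := ltP 0 (p w); last first.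
  have -> : p w = 0 by apply/eqP; rewrite eq_le t0 p_ge0.
  by rewrite !mulr0 if_same mul0r !subr0 sub0r oppr_le0 invr_ge0 ltW.
case: ifPn => [nlik|/negPn lk]; last first.
  rewrite subr0 (le_trans (_ : _ <= c * n%:R * p w))//.
    by rewrite gerBl invr_ge0 ltW.
  rewrite mulrC ler_wpM2l// -ler_expR lnK ?posrE ?divr_gt0//.
  by rewrite ler_pdivlMr.
have lnw : ln (p w) <= log_ratio w.
  rewrite /log_ratio ln_div ?posrE// lerBrDl gerDr.
  by rewrite -ler_expR lnK ?posrE// expR0; exact: word_weight_le1.
have := ln_le_subr1 (_ : 0 < (p w * (size s)%:R ^+ n)^-1).
rewrite invr_gt0 mulr_gt0// => /(_ isT).
rewrite lnV ?posrE ?mulr_gt0// lnM ?posrE// lnXn// -[ln _ *+ n]mulr_natr => H.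
have := ler_wpM2l (ltW t0) H.
rewrite mulrBr invfM mulrA divff ?gt_eqF// mul1r.
have := ler_wpM2l (ltW t0) lnw.
move: (log_ratio w) (_ ^- n) (ln (p w)) (ln _) n%:R t0 => lr x lp lN N.
by move: (p w) => P; nra.
Qed.

(** By [likely_dichotomy] the log-ratio per letter has a constant limit; a limit
    below [h] would contradict [block_entropy_lb], a limit above [h] would
    contradict [block_entropy_ub]. *)
Theorem shannon_mcmillan_breiman (h e : R) :
  entropy_step @ \oo --> h -> (forall n, entropy_step n <= h) -> 0 < e ->
  \forall x \ae mu, \forall n \near \oo, lik (h - e) n x /\ ~ lik (h + e) n x.
Proof.
move=> h_lim h_ub e0; have e20 : 0 < e / 2 by rewrite divr_gt0.
have mlik c n : measurable (lik c n) by exact: measurable_likely.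
have lower : \forall x \ae mu, \forall n \near \oo, lik (h - e) n x.
  have [H|rare] := likely_dichotomy (h - e / 2).
    by have := H _ e20; rewrite (_ : h - e / 2 - e / 2 = h - e)//; field.
  exfalso; set c := h - e / 2.
  have ch : c < h by rewrite /c; lra.
  have [m _ /(_ m (leqnn m)) /= cm] := cvgr_gt _ h_lim _ ch.
  pose g := (entropy_step m - c) / 2.
  have g0 : 0 < g by rewrite divr_gt0// subr_gt0.
  have [t [t0 Ht]] := small_multiple (- ln q0 - c) g0.
  have [n1 _ Hn1] := near_probability_lt (mlik c) rare t0.
  have [n2 _ /(_ n2 (leqnn n2)) /= Hn2] :=
    nbhs_infty_gtr (((c + g) * m%:R - block_entropy m) / g).
  pose n := maxn n1 n2.
  have Pt : fine (mu (lik c (m + n))) < t.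
    rewrite -lte_fin fineK ?fin_num_measure//; apply: Hn1 => /=.
    by rewrite (leq_trans (leq_maxl n1 n2))// leq_addl.
  have := Ht _ (fine_ge0 (measure_ge0 mu _)) Pt.
  have := block_entropy_lb m n.
  move=> /le_trans/(_ (block_entropy_rare c (m + n))).
  have : ((c + g) * m%:R - block_entropy m) / g < n%:R.
    by rewrite (lt_le_trans Hn2)// ler_nat leq_maxr.
  rewrite ltr_pdivrMr// natrD.
  have -> : entropy_step m = c + 2 * g by rewrite /g; field.
  move: (block_entropy m) (fine _) (ln q0) => J P l0 H1 H2 H3.
  have : (m%:R + n%:R) * ((- l0 - c) * P) <= (m%:R + n%:R) * g.
    by rewrite ler_wpM2l.
  move: H1 H2; move: m%:R n%:R => M N; nra.
have upper : \forall x \ae mu, \forall n \near \oo, ~ lik (h + e) n x.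
  have [H|//] := likely_dichotomy (h + e).
  exfalso; have := H _ e20; set c := h + e - e / 2 => {}H.
  have e40 : 0 < e / 4 by rewrite divr_gt0.
  have [t [t0 Ht]] := small_multiple (c + ln (size s)%:R) e40.
  have mlikC n : measurable (~` lik c n) by apply: measurableC.
  have H' : \forall x \ae mu, \forall n \near \oo, ~ (~` lik c n) x.
    by apply: filterS H => x; apply: filterS => n lx; apply.
  have [n1 _ Hn1] := near_probability_lt mlikC H' t0.
  have [n2 _ /(_ n2 (leqnn n2)) /= Hn2] := nbhs_infty_gtr (4 / e).
  pose n := maxn n1 n2.
  have Pt : fine (mu (~` lik c n)) < t.
    rewrite -lte_fin fineK ?fin_num_measure//; apply: Hn1 => /=.
    exact: leq_maxl.
  have := Ht _ (fine_ge0 (measure_ge0 mu _)) Pt.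
  have := le_trans (block_entropy_likely c n) (block_entropy_ub n h_ub).
  have : 4 / e < n%:R by rewrite (lt_le_trans Hn2)// ler_nat leq_maxr.
  rewrite ltr_pdivrMr// (_ : c = h + e / 2); last by rewrite /c; field.
  move: (fine _) (ln _) => P l0 H1 H2 H3.
  have : n%:R * ((h + e / 2 + l0) * P) <= n%:R * (e / 4).
    by rewrite ler_wpM2l.
  move: H1 H2; move: n%:R => N; nra.
apply: filterS2 lower upper => x; apply: filterS2 => n; by split.
Qed.

End entropy.

(** * Distortion balls around typical words *)

Section exponential_tilting.
Context (R : realType) (A : choiceType) (s : seq A) (rho : A -> A -> R).
Hypothesis s_all : forall a, a \in s.

Definition total_distortion (u v : seq A) : R :=
  \sum_(z <- zip u v) rho z.1 z.2.

Definition word_ball (w : seq A) (D : R) : pred (seq A) :=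
  fun v => (size w)%:R^-1 * total_distortion w v <= D.

Lemma total_distortion_cons a u b v :
  total_distortion (a :: u) (b :: v) = rho a b + total_distortion u v.
Proof. by rewrite /total_distortion big_cons. Qed.

(** The tilted sums factor over the letters, because the distortion is
    additive. *)
Lemma tilted_sum_right (g : A -> R) (t : R) (w : seq A) :
  \sum_(v <- words s (size w))
    (\prod_(b <- v) g b) * expR (- t * total_distortion w v) =
  \prod_(a <- w) \sum_(b <- s) g b * expR (- t * rho a b).
Proof.
elim: w => [|a w IH].
  by rewrite sum_words0 !big_nil /total_distortion big_nil mulr0 expR0 mulr1.
rewrite sum_words_cons big_cons -IH mulr_suml; apply: eq_bigr => b _.
rewrite mulr_sumr; apply: eq_bigr => v _.
by rewrite big_cons total_distortion_cons mulrDr expRD; ring.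
Qed.

Lemma tilted_sum_left (t : R) (v : seq A) :
  \sum_(w <- words s (size v)) expR (- t * total_distortion w v) =
  \prod_(b <- v) \sum_(a <- s) expR (- t * rho a b).
Proof.
elim: v => [|b v IH].
  by rewrite sum_words0 !big_nil /total_distortion big_nil mulr0 expR0.
rewrite sum_words_cons big_cons -IH mulr_suml; apply: eq_bigr => a _.
rewrite mulr_sumr; apply: eq_bigr => w _.
by rewrite total_distortion_cons mulrDr expRD.
Qed.

(** Chernoff's bound: on the ball the tilting factor is at least
    [expR (- t * D * n)], for words of length [n]. *)
Lemma ball_sum_le (g : seq A -> R) (t D : R) (w : seq A) :
  (forall v, 0 <= g v) -> 0 <= t ->
  \sum_(v <- words s (size w) | word_ball w D v) g v <=
  expR (t * D * (size w)%:R) *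
    \sum_(v <- words s (size w)) g v * expR (- t * total_distortion w v).
Proof.
move=> g0 t0; rewrite big_mkcond/= mulr_sumr; apply: ler_sum_words => // v vw.
case: ifPn => [vB|_]; last by rewrite !mulr_ge0 ?expR_ge0.
rewrite mulrCA ler_peMr// -expRD -[leLHS]expR0 ler_expR mulNr subr_ge0 -mulrA.
rewrite ler_wpM2l//; case: (w) vw vB => [|a w'] vw vB.
  by rewrite (size0nil vw) /total_distortion big_nil mulr0.
by rewrite mulrC -ler_pdivrMl//; exact: vB.
Qed.

Variable r0 : R.

Lemma tilted_sum_le (g f : A -> R) (t : R) (a : A) :
  uniq s -> 0 <= t -> (forall b, 0 <= g b <= 1) ->
  (forall b, b != a -> r0 <= f b) -> f a = 0 ->
  \sum_(b <- s) g b * expR (- t * f b) <= g a + (size s)%:R * expR (- t * r0).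
Proof.
move=> us t0 g01 fr fa; rewrite (bigD1_seq a)//= fa mulr0 expR0 mulr1 lerD2l.
apply: (@le_trans _ _ (\sum_(b <- s) expR (- t * r0))); last first.
  by rewrite big_const_seq count_predT iter_addr_0 mulr_natl.
rewrite big_mkcond/=; apply: ler_sum => b _.
case: ifPn => [ba|_]; last exact: expR_ge0.
have /andP[gb0 gb1] := g01 b.
rewrite (le_trans (ler_wpM2r (expR_ge0 _) gb1))// mul1r ler_expR.
by rewrite !mulNr lerN2 ler_wpM2l// fr.
Qed.

End exponential_tilting.

Section ball_asymptotics.
Context d (T : measurableType d) (R : realType) (mu : probability T R).
Variable S : T -> T.
Hypothesis mS : measurable_fun [set: T] S.
Hypothesis muS : forall B, measurable B -> mu (S @^-1` B) = mu B.
Context (A : choiceType) (s : seq A).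
Hypothesis s_all : forall a, a \in s.
Hypothesis s_uniq : uniq s.
Variable letter : T -> A.
Hypothesis mletter : forall B : set A, measurable (letter @^-1` B).
Variable q : A -> R.
Hypothesis q_gt0 : forall a, 0 < q a.
Hypothesis q_le1 : forall a, q a <= 1.
Variable rho : A -> A -> R.
Hypothesis rho_gt0 : forall a b, a != b -> 0 < rho a b.
Hypothesis rho_diag : forall a, rho a a = 0.

Let p := word_prob mu S letter.
Let wd := word S letter.

Definition ball_sum (g : seq A -> R) (w : seq A) (D : R) : R :=
  \sum_(v <- words s (size w) | word_ball rho w D v) g v.

Lemma ball_sum_ge g w D : 0 <= D -> (forall v, 0 <= g v) -> g w <= ball_sum g w D.
Proof.
move=> D0 g0; rewrite /ball_sum big_mkcond/= (big_rem w)/=; last by rewrite mem_words.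
rewrite (_ : word_ball rho w D w); first by rewrite lerDl sumr_ge0// => v _; case: ifP.
rewrite /word_ball (_ : total_distortion _ _ _ = 0) ?mulr0//.
rewrite /total_distortion; elim: w => [|a w IH]; first by rewrite big_nil.
by rewrite /= big_cons IH rho_diag addr0.
Qed.

(** The tilt [t] is chosen so large that all letters other than the central one
    together add at most a factor [k = 1 + e / 3] per letter; then [D0] is
    chosen so small that undoing the tilt costs at most a factor
    [expR (e / 3)] per letter. For p, a further factor [expR (e / 3)] comes
    from [word_borel_cantelli]. *)
Lemma ball_sum_small (e : R) : 0 < e -> exists D0, 0 < D0 /\
  (forall w D, D <= D0 ->
    ball_sum (word_weight q) w D <= expR (e * (size w)%:R) * word_weight q w) /\
  \forall x \ae mu, \forall n \near \oo, forall D, D <= D0 ->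
    ball_sum p (wd n x) D <= expR (e * n%:R) * p (wd n x).
Proof.
move=> e0.
have [r0 [r0_gt0 rho_ge]] : exists r0, 0 < r0 /\ forall a b, a != b -> r0 <= rho a b.
  have [|m [m0 Hm]] := @seq_positive_lower_bound _ _
      [seq (a, b) | a <- s, b <- [seq b <- s | b != a]] (fun z => rho z.1 z.2).
    move=> z /allpairsPdep[a [b [_ + ->]]]; rewrite mem_filter => /andP[ba _].
    by apply: rho_gt0; rewrite eq_sym.
  exists m; split => // a b ab; apply: (Hm (a, b)).
  by apply/allpairsPdep; exists a, b; rewrite mem_filter eq_sym ab !s_all.
have [q0 [q0_gt0 Hq]] := @seq_positive_lower_bound _ _ s q (fun a _ => q_gt0 a).
have {}Hq a : q0 <= q a by apply: Hq.
have q0_le1 : q0 <= 1 by rewrite (le_trans (Hq (letter point))).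
have N0 : 0 < (size s)%:R :> R by rewrite ltr0n; exact: size_alphabet_gt0 letter.
(* dividing by [q0] later turns this additive error into a relative one *)
pose z : R := e / 3 * q0 / (size s)%:R.
have z0 : 0 < z by rewrite !(divr_gt0, mulr_gt0).
pose t := Num.max 0 (- ln z / r0).
have t0 : 0 <= t by rewrite le_max lexx.
have tz : expR (- t * r0) <= z.
  rewrite -[leRHS]lnK ?posrE// ler_expR mulNr lerNl.
  by rewrite -ler_pdivrMr// le_max lexx orbT.
pose k : R := 1 + e / 3.
have k0 : 0 < k by rewrite addr_gt0// divr_gt0.
have ke : k <= expR (e / 3) by exact: expR_ge1Dx.
have Nz : (size s)%:R * expR (- t * r0) <= e / 3 * q0.
  by rewrite mulrC -ler_pdivlMr.
pose D0 := e / 3 / (t + 1).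
have D00 : 0 < D0 by rewrite !divr_gt0// ltr_wpDl.
have tD D : D <= D0 -> t * D <= e / 3.
  move=> DD; apply: (le_trans (ler_wpM2l t0 DD)).
  rewrite /D0 mulrA ler_pdivrMr ?ltr_wpDl// mulrC ler_wpM2l ?lerDl//.
  by rewrite divr_ge0// ltW.
have e3n n : expR (e * n%:R) = expR (e / 3 * n%:R) * (expR (e / 3 * n%:R) * expR (e / 3 * n%:R)).
  by rewrite -!expRD; congr expR; field.
exists D0; split => //; split.
  move=> w D DD.
  have w_ge0 v : 0 <= word_weight q v by rewrite ltW// word_weight_gt0.
  apply: (le_trans (ball_sum_le rho s_all D w w_ge0 t0)).
  rewrite tilted_sum_right e3n -[leRHS]mulrA; apply: ler_pM; rewrite ?expR_ge0//.
  - apply: prodr_ge0 => a _; apply: sumr_ge0 => b _.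
    by rewrite mulr_ge0 ?expR_ge0// ltW.
  - by rewrite ler_expR ler_wpM2r// tD.
  - apply: (@le_trans _ _ (k ^+ size w * word_weight q w)); last first.
      rewrite expRM_natr -mulrA ler_pM ?exprn_ge0 ?(ltW k0)//.
      + by rewrite lerXn2r ?nnegrE ?(ltW k0)// expR_ge0.
      + rewrite ler_peMl ?(ltW (word_weight_gt0 _ _))// exprn_ege1//.
        by rewrite -expR0 ler_expR divr_ge0// ltW.
    elim: w => [|a w IH]; first by rewrite big_nil /word_weight big_nil mulr1.
    rewrite big_cons word_weight_cons exprS.
    rewrite (_ : _ * _ * _ = (k * q a) * (k ^+ size w * word_weight q w)); last by ring.
    apply: ler_pM => //.
    + by apply: sumr_ge0 => b _; rewrite mulr_ge0 ?expR_ge0// ltW.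
    + apply: prodr_ge0 => b _; apply: sumr_ge0 => c _.
      by rewrite mulr_ge0 ?expR_ge0// ltW.
    + apply: (le_trans (@tilted_sum_le _ _ s s_all r0 q (rho a) t a s_uniq t0 _ _ _)).
      * by move=> b; rewrite q_le1 ltW.
      * by move=> b; rewrite eq_sym; exact: rho_ge.
      * exact: rho_diag.
      * rewrite mulrDl mul1r lerD2l (le_trans Nz)// ler_wpM2l//.
        by rewrite divr_ge0// ltW.
have sum1 b : \sum_(a <- s) expR (- t * rho a b) <= k.
  under eq_bigr do rewrite -[expR _]mul1r.
  apply: (le_trans (@tilted_sum_le _ _ s s_all r0 (fun=> 1) (rho ^~ b) t b
    s_uniq t0 _ _ _)) => //.
  - by move=> c; rewrite ler01 lexx.
  - by move=> a; exact: rho_ge.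
  - by rewrite lerD2l (le_trans Nz)// ler_piMr// divr_ge0// ltW.
have p0 w : 0 <= p w by exact: word_prob_ge0.
pose V w := \sum_(v <- words s (size w)) p v * expR (- t * total_distortion rho w v).
have V0 w : 0 <= V w by apply: sumr_ge0 => v _; rewrite mulr_ge0 ?expR_ge0.
have sumV n : \sum_(w <- words s n) k ^- n * V w <= 1.
  rewrite -mulr_sumr ler_pdivrMl ?exprn_gt0// mulr1.
  rewrite (eq_sum_words s_all (G := fun w => \sum_(v <- words s n)
    p v * expR (- t * total_distortion rho w v))); last by move=> w wn; rewrite /V wn.
  rewrite exchange_big/=.
  rewrite -[leRHS]mulr1 -(sum_word_prob mu mS s_all s_uniq mletter n) mulr_sumr.
  apply: ler_sum_words => // v vn; rewrite -mulr_sumr mulrC ler_wpM2r//.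
  rewrite -vn tilted_sum_left.
  elim: (v) => [|b v' IH]; first by rewrite big_nil.
  rewrite big_cons exprS ler_pM//.
  - by apply: sumr_ge0 => a _; exact: expR_ge0.
  - by apply: prodr_ge0 => c _; apply: sumr_ge0 => a _; exact: expR_ge0.
have e30 : 0 < e / 3 by rewrite divr_gt0.
have V0' n w : 0 <= k ^- n * V w by rewrite mulr_ge0// invr_ge0 exprn_ge0// ltW.
have := @word_borel_cantelli _ _ _ mu _ mS _ _ s_all s_uniq _ mletter
  (fun n w => k ^- n * V w) (e / 3) V0' sumV e30.
apply: filterS => x; apply: filterS => n HV D DD.
have kn : k ^+ n <= expR (e / 3 * n%:R).
  by rewrite expRM_natr lerXn2r ?nnegrE ?(ltW k0)// expR_ge0.
move: HV; rewrite ltr_pdivrMl ?exprn_gt0// => /ltW HV.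
apply: (le_trans (ball_sum_le rho s_all D _ p0 t0)).
rewrite size_word e3n -[leRHS]mulrA; apply: ler_pM; rewrite ?expR_ge0//.
- by have := V0 (wd n x); rewrite /V size_word.
- by rewrite ler_expR ler_wpM2r// tD.
- have := HV; rewrite /V size_word => /le_trans; apply.
  by rewrite mulrA ler_wpM2r// ler_wpM2r// expR_ge0.
Qed.

Variable h : R.
Hypothesis ergS : ergodic_map mu S.
Hypothesis step_lim : entropy_step mu S s letter q @ \oo --> h.
Hypothesis step_ub : forall n, entropy_step mu S s letter q n <= h.

Theorem ball_ratio_limit (e : R) : 0 < e -> exists D0, 0 < D0 /\
  \forall x \ae mu, \forall n \near \oo, forall D, 0 <= D <= D0 ->
    `|n%:R^-1 * ln (ball_sum p (wd n x) D / ball_sum (word_weight q) (wd n x) D) - h|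
      <= e.
Proof.
move=> e0; have e20 : 0 < e / 2 by rewrite divr_gt0.
have [D0 [D00 [Hq Hp]]] := ball_sum_small e20.
have [q0 [q0_gt0 Hq0]] := @seq_positive_lower_bound _ _ s q (fun a _ => q_gt0 a).
have {}Hq0 a : q0 <= q a by apply: Hq0.
have smb := shannon_mcmillan_breiman mS muS s_all s_uniq mletter q_gt0 q_le1
  q0_gt0 Hq0 ergS step_lim step_ub e20.
exists D0; split => //; near=> x; near=> n => D /andP[D_ge0 DD].
have n0 : (0 < n)%N by near: n; exact: nbhs_infty_gt.
have Hp1 : ball_sum p (wd n x) D <= expR (e / 2 * n%:R) * p (wd n x).
  suff : forall D', D' <= D0 ->
    ball_sum p (wd n x) D' <= expR (e / 2 * n%:R) * p (wd n x) by apply.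
  by near: n; near: x.
have [] : likely mu S letter q (h - e / 2) n x /\
    ~ likely mu S letter q (h + e / 2) n x by near: n; near: x.
rewrite /likely/= -/wd -/p => lo /negP; rewrite -ltNge => hi.
have := Hq (wd n x) D DD; rewrite size_word => {}Hq.
have w0 : 0 < word_weight q (wd n x) by exact: word_weight_gt0.
have p0 : 0 < p (wd n x) by rewrite (lt_le_trans _ lo)// mulr_gt0// expR_gt0.
have Hp' : p (wd n x) <= ball_sum p (wd n x) D.
  by apply: ball_sum_ge => // v; exact: word_prob_ge0.
have Hq' : word_weight q (wd n x) <= ball_sum (word_weight q) (wd n x) D.
  by apply: ball_sum_ge => // v; rewrite ltW// word_weight_gt0.
have bp0 := lt_le_trans p0 Hp'; have bq0 := lt_le_trans w0 Hq'.
have n0' : 0 < n%:R :> R by rewrite ltr0n.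
rewrite ler_distl; apply/andP; split.
- rewrite -ler_pdivrMl ?invr_gt0// invrK [n%:R * _]mulrC -ler_expR lnK ?posrE ?divr_gt0//.
  rewrite ler_pdivlMr//; apply: le_trans Hp'; apply: le_trans lo.
  apply: (le_trans (ler_wpM2l (expR_ge0 _) Hq)).
  rewrite mulrA -expRD ler_wpM2r ?(ltW w0)// ler_expR.
  by move: n%:R => N; lra.
- rewrite ler_pdivrMl// [n%:R * _]mulrC -ler_expR lnK ?posrE ?divr_gt0//.
  rewrite ler_pdivrMr//; apply: (le_trans Hp1).
  apply: (le_trans (ler_wpM2l (expR_ge0 _) (ltW hi))).
  rewrite mulrA -expRD ler_pM ?expR_ge0 ?(ltW w0)// ler_expR.
  by move: n%:R => N; lra.
Unshelve. all: by end_near. Qed.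

End ball_asymptotics.

(** * A process as a shift on its path space *)

Section path_system.
Context d (A : measurableType d).

Definition path_space : Type := g_sigma_algebraType (@path_coordinate_events d A).
HB.instance Definition _ := Measurable.on path_space.

Definition shift : path_space -> path_space := @path_shift d A.

Lemma measurable_shift : measurable_fun [set: path_space] shift.
Proof.
refine (@measurability _ _ path_space path_space setT shift (@path_coordinate_events d A) erefl _).
move=> _ [_ [i _ [B mB <-]] <-]; apply: sub_sigma_algebra.
by exists i.+1 => //; exists B => //; apply/seteqP; split.
Qed.

Definition first_letter (x : path_space) : A := x 0%N.

Lemma measurable_first_letter (B : set A) :
  measurable B -> measurable (first_letter @^-1` B).
Proof.
move=> mB; apply: sub_sigma_algebra; exists 0%N => //; exists B => //.
by apply/seteqP; split => x //= [].
Qed.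

Lemma word_path n (x : path_space) :
  word shift first_letter n x = mkseq x n.
Proof.
elim: n x => //= n IH x; rewrite IH /mkseq /= -[1%N]addn0 iotaDl -map_comp.
by [].
Qed.

Context dO (Omega : measurableType dO) (R : realType) (P : probability Omega R).
Variable X : nat -> {RV P >-> A}.

Definition path_of (w : Omega) : path_space := trajectory X w.

Lemma measurable_path_of : measurable_fun [set: Omega] path_of.
Proof.
refine (@measurability _ _ Omega path_space setT path_of (@path_coordinate_events d A) erefl _).
move=> _ [_ [i _ [B mB <-]] <-].
rewrite (_ : _ `&` _ = X i @^-1` B); last first.
  by apply/seteqP; split => x /=; [case=> _ []|].
by rewrite -[X in measurable X]setTI; exact: (measurable_funPT (X i)).
Qed.

HB.instance Definition _ :=
  isMeasurableFun.Build _ _ _ _ path_of measurable_path_of.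

Definition path_law : probability path_space R := distribution P path_of.

Lemma path_law_stationary : stationary X ->
  forall B : set path_space, measurable B ->
    path_law (shift @^-1` B) = path_law B.
Proof. by move=> statX B mB; exact: statX. Qed.

Lemma path_law_ergodic : ergodic X ->
  ergodic_map path_law shift.
Proof. by move=> ergX B mB BE; exact: ergX. Qed.

Lemma ae_path_law (E : path_space -> Prop) :
  (\forall x \ae path_law, E x) -> \forall w \ae P, E (path_of w).
Proof.
move=> [N [mN N0 EN]]; exists (path_of @^-1` N); split => //.
  by rewrite -[X in measurable X]setTI; exact: measurable_path_of.
by move=> w /= nE; apply: EN.
Qed.

Lemma block_word n w : tval (block X n w) =
  word shift first_letter n (path_of w).
Proof.
rewrite word_path; apply: (@eq_from_nth _ point).
  by rewrite size_tuple size_mkseq.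
move=> i; rewrite size_tuple => ilt; rewrite nth_mkseq//.
by rewrite -(tnth_nth point _ (Ordinal ilt)) tnth_mktuple.
Qed.

End path_system.

(** * Block laws over a finite alphabet *)

Section finite_tuples.
Context d (A : measurableType d) (R : realType).
Context (s : seq A) (s_all : forall a, a \in s) (s_uniq : uniq s).
Hypothesis discrA : forall B : set A, measurable B.

Lemma tval_words n (t : n.-tuple A) : tval t \in words s n.
Proof. by rewrite mem_words// size_tuple. Qed.

Lemma measurable_tval1 n (w : seq A) :
  measurable ((@tval n A) @^-1` [set w]).
Proof.
have [wn|wn] := eqVneq (size w) n; last first.
  rewrite (_ : _ @^-1` _ = set0)//; apply/seteqP; split => t //= tw.
  by move: wn; rewrite -tw size_tuple eqxx.
rewrite (_ : _ @^-1` _ = \bigcap_(i in [set: 'I_n])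
    ((fun t : n.-tuple A => tnth t i) @^-1` [set nth point w i])).
  apply: fin_bigcap_measurable => // i _.
  rewrite -[X in measurable X]setTI; exact: measurable_tnth.
apply/seteqP; split => [t /= tw i _|t /= H].
  by rewrite /= (tnth_nth point) tw.
apply: (@eq_from_nth _ point); rewrite ?size_tuple// => i ilt.
by have := H (Ordinal ilt) I; rewrite /= (tnth_nth point).
Qed.

Lemma measurable_tuple_set n (B : set (n.-tuple A)) : measurable B.
Proof.
rewrite (_ : B = (@tval n A) @^-1` ((@tval n A) @` B)).
  exact: (measurable_finite_preimage (@measurable_tval1 n) (@tval_words n)).
apply/seteqP; split => [t Bt|t [u Bu /val_inj <-]//].
by exists t.
Qed.

Variable Q : probability A R.

Definition letter_mass (a : A) : R := fine (Q [set a]).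

Lemma product_law_tuple n (t : n.-tuple A) :
  product_law Q n [set t] = (word_weight letter_mass t)%:E.
Proof.
elim: n t => [|n IH] t.
  rewrite (tuple0 t) /= /word_weight big_nil diracE mem_set//.
case/tupleP: t => a t.
rewrite [LHS](_ : _ = (Q \x product_law Q n)%E ([set a] `*` [set t])); last first.
  rewrite /= /distribution /pushforward; congr (_ _).
  apply/seteqP; split => [[b u] /= /(congr1 val)/= [-> /val_inj ->]//|].
  by move=> [b u] /= [-> ->].
rewrite product_measure1E//; last exact: measurable_tuple_set.
rewrite word_weight_cons EFinM /letter_mass fineK ?fin_num_measure//.
by congr (_ * _)%E; exact: IH.
Qed.

Lemma tuple_prob n (nu : probability (n.-tuple A) R) (f : seq A -> R)
    (B : pred (seq A)) :
  (forall t : n.-tuple A, nu [set t] = (f t)%:E) ->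
  fine (nu [set t | B (tval t)]) = \sum_(w <- words s n | B w) f w.
Proof.
move=> nuf; rewrite (finite_probability _ (@measurable_tval1 n) _ (@tval_words n)); last first.
  exact: words_uniq.
rewrite big_seq_cond [RHS]big_seq_cond; apply: eq_bigr => w /andP[].
rewrite mem_words// => /eqP wn _.
have wn' : size w == n by apply/eqP.
rewrite (_ : _ @^-1` _ = [set Tuple wn']) ?nuf//.
apply/seteqP; split => t /=; last by move=> ->.
by move=> tw; apply: val_inj.
Qed.

Lemma tuple_expectation n (nu : probability (n.-tuple A) R) (f g : seq A -> R) :
  (forall t : n.-tuple A, nu [set t] = (f t)%:E) ->
  ('E_nu[fun t => g (tval t)] = (\sum_(w <- words s n) f w * g w)%:E)%E.
Proof.
move=> nuf; rewrite unlock.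
rewrite (finite_expectation _ (@measurable_tval1 n) _ (@tval_words n)); last first.
  exact: words_uniq.
congr (_%:E); apply: eq_sum_words => // w wn; congr (_ * _).
have wn' : size w == n by apply/eqP.
rewrite (_ : _ @^-1` _ = [set Tuple wn']) ?nuf//.
by apply/seteqP; split => t /= => [tw|->//]; apply: val_inj.
Qed.

End finite_tuples.

Section process_blocks.
Context d (A : measurableType d) (R : realType).
Context (s : seq A) (s_all : forall a, a \in s) (s_uniq : uniq s).
Hypothesis discrA : forall B : set A, measurable B.
Context dO (Omega : measurableType dO) (P : probability Omega R).
Variable X : nat -> {RV P >-> A}.
Variable Q : probability A R.
Hypothesis Q_gt0 : forall a, (0 < Q [set a])%E.

Let p := word_prob (path_law X) (@shift d A) (@first_letter d A).
Let ww := word_weight (letter_mass Q).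

Lemma letter_mass_gt0 a : 0 < letter_mass Q a.
Proof. by rewrite -lte_fin fineK ?fin_num_measure. Qed.

Lemma letter_mass_le1 a : letter_mass Q a <= 1.
Proof. by rewrite -lee_fin fineK ?fin_num_measure// probability_le1. Qed.

Let ww_gt0 w : 0 < ww w.
Proof. by apply: word_weight_gt0; exact: letter_mass_gt0. Qed.

Lemma block_law_tuple n (t : n.-tuple A) :
  block_law X n [set t] = (word_prob (path_law X) (@shift d A) (@first_letter d A) t)%:E.
Proof.
rewrite /word_prob fineK; last first.
  rewrite fin_num_measure//; apply: (measurable_word (@measurable_shift d A) s_all).
  by move=> B; exact: measurable_first_letter.
rewrite size_tuple [LHS]/(P _) [RHS]/(P _) /=.
rewrite /block_law /path_law /distribution /pushforward; congr (P _).
apply/seteqP; split => w /=; first by move=> <-; rewrite block_word.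
by rewrite -block_word => /val_inj.
Qed.

(** Every singleton has positive mass under the product law, so the almost
    everywhere defined density is determined at every point. *)
Lemma block_density_tuple n (t : n.-tuple A) :
  block_density X Q t = (p t / ww t)%:E.
Proof.
have mtuple (B : set (n.-tuple A)) : measurable B.
  exact: (measurable_tuple_set s_all discrA).
have Qt (u : n.-tuple A) : product_law Q n [set u] = (ww u)%:E.
  exact: (product_law_tuple s_all discrA).
have dom : charge_of_finite_measure (block_law X n) `<< product_law Q n.
  apply/null_content_dominatesP => B mB QB0.
  suff -> : B = set0 by exact: (measure0 (block_law X n)).
  apply/seteqP; split => // u Bu.
  have : (product_law Q n [set u] <= product_law Q n B)%E.
    by rewrite le_measure ?inE//; move=> v ->.
  by rewrite QB0 Qt lee_fin leNgt ww_gt0.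
have := Radon_Nikodym_integral dom (mtuple [set t]).
rewrite (eq_integral (cst (block_density X Q t))); last first.
  by move=> u; rewrite inE => ->.
rewrite integral_cst// [X in (_ * X)%E]Qt.
rewrite [LHS]block_law_tuple -/p => pE.
have fin : block_density X Q t \is a fin_num by exact: Radon_Nikodym_fin_num.
move: pE; rewrite -(fineK fin) -EFinM => -[->].
by rewrite mulfK// gt_eqF.
Qed.

Lemma entropy_incrementE n : entropy_increment X Q n =
  (entropy_step (path_law X) (@shift d A) s (@first_letter d A) (letter_mass Q) n)%:E.
Proof.
rewrite /entropy_increment.
pose g w := ln (p w / ww w / (p (take n w) / ww (take n w))).
rewrite (_ : (fun x => _) = (fun t : n.+1.-tuple A => g (tval t))); last first.
  apply/funext => t; rewrite !block_density_tuple /= /g.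
  suff -> : tval (tuple_prefix t) = take n t by [].
  apply: (@eq_from_nth _ point).
    by rewrite size_tuple size_takel// size_tuple.
  move=> i; rewrite size_tuple => ilt.
  rewrite -(tnth_nth point _ (Ordinal ilt)) tnth_mktuple nth_take//.
  by rewrite (tnth_nth point).
rewrite (tuple_expectation s_all s_uniq discrA g (@block_law_tuple n.+1)).
congr (_%:E); rewrite sum_words_rcons /entropy_step.
apply: eq_sum_words => // w wn; apply: eq_bigr => a _.
rewrite /g -cats1 take_size_cat// cats1 -/p.
have [t0|t0] := ltP 0 (p (rcons w a)); last first.
  have -> : p (rcons w a) = 0.
    by apply/eqP; rewrite eq_le t0 /=; exact: word_prob_ge0.
  by rewrite !mul0r.
have pw : 0 < p w.
  rewrite (lt_le_trans t0)//; apply: (word_prob_rcons_le _ (@measurable_shift d A) s_all s_uniq).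
  by move=> B; exact: measurable_first_letter.
by rewrite ln_div ?posrE ?divr_gt0.
Qed.

Context (rho : A -> A -> R).

Lemma block_distortionE n (x y : n.-tuple A) :
  block_distortion rho x y = (size x)%:R^-1 * total_distortion rho x y.
Proof.
rewrite /block_distortion size_tuple; congr (_ * _).
elim: n x y => [|n IH] x y.
  by rewrite big_ord0 (tuple0 x) (tuple0 y) /total_distortion big_nil.
case/tupleP: x => a x; case/tupleP: y => b y.
rewrite big_ord_recl !tnth0 total_distortion_cons -IH; congr (_ + _).
by apply: eq_bigr => i _; rewrite !tnthS.
Qed.

Lemma log_ball_ratioE w n D :
  let u := word (@shift d A) (@first_letter d A) n (path_of X w) in
  log_ball_ratio X Q rho w n D =
  n%:R^-1 * ln (ball_sum s rho p u D / ball_sum s rho ww u D).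
Proof.
move=> u; rewrite /log_ball_ratio.
have -> : distortion_ball rho (block X n w) D =
    [set y | word_ball rho u D (tval y)].
  apply/seteqP; split => y; rewrite /distortion_ball /= block_distortionE block_word;
  by rewrite /word_ball.
rewrite (tuple_prob s_all s_uniq discrA _ (@block_law_tuple n)).
rewrite (tuple_prob s_all s_uniq discrA _
  (@product_law_tuple _ _ _ _ s_all discrA Q n)).
by rewrite /ball_sum /u size_word.
Qed.

End process_blocks.

(** * The double limit and the repeated limit *)

(** Only finitely many words have the length of [w], so the positive distances
    to [w] have a positive minimum. *)
Lemma ball_sum_near0 (R : realType) (A : choiceType) (s : seq A)
    (rho : A -> A -> R) (g : seq A -> R) (w : seq A) :
  (forall a b, 0 <= rho a b) ->
  \forall D \near (0 : R)^'+, ball_sum s rho g w D = ball_sum s rho g w 0.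
Proof.
move=> rho0.
pose dist v := (size w)%:R^-1 * total_distortion rho w v.
have dist0 v : 0 <= dist v by rewrite mulr_ge0// sumr_ge0.
have [|m [m0 Hm]] := @seq_positive_lower_bound _ _
    [seq v <- words s (size w) | 0 < dist v] dist.
  by move=> v; rewrite mem_filter => /andP[].
near=> D; rewrite /ball_sum big_seq_cond [RHS]big_seq_cond; apply: eq_bigl => v.
have [vw|//] := boolP (v \in words s (size w)); rewrite /= /word_ball -/(dist v).
have D0 : 0 < D by near: D; exact: nbhs_right_gt.
have Dm : D < m by near: D; exact: nbhs_right_lt.
have [v0|v0] := ltP 0 (dist v).
  have mv : m <= dist v by apply: Hm; rewrite mem_filter v0.
  by rewrite (lt_geF (lt_le_trans Dm mv)).
by rewrite (le_trans v0 (ltW D0)).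
Unshelve. all: by end_near. Qed.

Theorem theorem7 (R : realType)
    (dA : measure_display) (A : measurableType dA)
    (finA : finite_set [set: A]) (discrA : forall B : set A, measurable B)
    (dX : measure_display) (OX : measurableType dX) (PX : probability OX R)
    (X : nat -> {RV PX >-> A}) (statX : stationary X) (ergX : ergodic X)
    (dY : measure_display) (OY : measurableType dY) (PY : probability OY R)
    (Y : nat -> {RV PY >-> A}) (Q : probability A R)
    (iidY : iid_with_marginal Y Q)
    (rho : A -> A -> R) (rho_ge0 : forall x y, 0 <= rho x y)
    (rho_eq0 : forall x y, rho x y = 0 <-> x = y)
    (Q_gt0 : forall x : A, (0 < Q [set x])%E) :
  {ae PX, forall w : OX,
    (log_ball_ratio X Q rho w nD.1 nD.2)%:E @[nD --> (\oo, (0 : R)^'+)]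
      --> relative_entropy_rate X Q} /\
  {ae PX, forall w : OX,
    (forall n : nat, (0 < n)%N ->
       cvg (log_ball_ratio X Q rho w n D @[D --> (0 : R)^'+])) /\
    (lim (log_ball_ratio X Q rho w n D @[D --> (0 : R)^'+]))%:E @[n --> \oo]
      --> relative_entropy_rate X Q}.
Proof.
have [s0 s0E] := (finite_seqP _).1 finA.
pose s := undup s0.
have s_uniq : uniq s by exact: undup_uniq.
have s_all a : a \in s.
  by rewrite mem_undup; have : [set: A] a by []; rewrite s0E.
pose mu := path_law X; pose S := @shift dA A; pose letter := @first_letter dA A.
have mS : measurable_fun [set: path_space A] S by exact: measurable_shift.
have muS B : measurable B -> mu (S @^-1` B) = mu B by exact: path_law_stationary.
have ergS : ergodic_map mu S by exact: path_law_ergodic.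
have mletter B : measurable (letter @^-1` B) by exact: measurable_first_letter.
pose q := letter_mass Q.
have q_gt0 a : 0 < q a by exact: letter_mass_gt0.
have q_le1 a : q a <= 1 by exact: letter_mass_le1.
have rho_diag a : rho a a = 0 by apply/rho_eq0.
have rho_gt0 a b : a != b -> 0 < rho a b.
  move=> ab; rewrite lt_neqAle rho_ge0 andbT eq_sym.
  by apply/eqP => /rho_eq0 E; rewrite E eqxx in ab.
have [q0 [q0_gt0 Hq0]] := @seq_positive_lower_bound _ _ s q (fun a _ => q_gt0 a).
have {}Hq0 a : q0 <= q a by apply: Hq0.
have [h [h_lim h_ub]] := entropy_step_cvg mS muS s_all s_uniq mletter q_gt0 q0_gt0 Hq0.
have hE : relative_entropy_rate X Q = h%:E.
  apply/cvg_lim => //.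
  rewrite (_ : entropy_increment X Q = EFin \o entropy_step mu S s letter q).
    by apply: cvg_EFin => //; exact: nearW.
  by apply/funext => n; exact: entropy_incrementE.
rewrite hE.
pose f := log_ball_ratio X Q rho.
have fE w n D : f w n D = n%:R^-1 * ln
    (ball_sum s rho (word_prob mu S letter) (word S letter n (path_of X w)) D /
     ball_sum s rho (word_weight q) (word S letter n (path_of X w)) D).
  exact: log_ball_ratioE.
have good : \forall w \ae PX, forall e : R, 0 < e -> exists D0, 0 < D0 /\
    \forall n \near \oo, forall D, 0 <= D <= D0 -> `|f w n D - h| <= e.
  have : \forall w \ae PX, forall k : nat, exists D0, 0 < D0 /\
      \forall n \near \oo, forall D, 0 <= D <= D0 ->
        `|f w n D - h| <= k.+1%:R^-1.
    apply: ae_foralln => k.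
    have k0 : 0 < k.+1%:R^-1 :> R by rewrite invr_gt0.
    have [D0 [D00 HD]] := ball_ratio_limit mS muS s_all s_uniq mletter q_gt0 q_le1
      rho_gt0 rho_diag ergS h_lim h_ub k0.
    apply: filterS (ae_path_law HD) => w Hw; exists D0; split => //.
    by apply: filterS Hw => n Hn D DD; rewrite fE; exact: Hn.
  apply: filterS => w Hw e e0.
  have [k _ /(_ k (leqnn k)) /= ke] := near_infty_natSinv_lt (PosNum e0).
  have [D0 [D00 HD]] := Hw k; exists D0; split => //.
  by apply: filterS HD => n Hn D DD; rewrite (le_trans (Hn D DD))// ltW.
split; apply: filterS good => w Hw.
  apply: cvg_EFin; first exact: nearW.
  apply/cvgrPdist_le => e e0; have [D0 [D00 [N _ HN]]] := Hw e e0.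
  exists ([set n | (N <= n)%N], [set D | 0 < D <= D0]) => /=.
    split; first by exists N.
    near=> D => /=; apply/andP; split.
      by near: D; exact: nbhs_right_gt.
    by near: D; exact: nbhs_right_le.
  move=> [n D] /= [nN /andP[D_gt0 DD]]; rewrite distrC.
  by apply: HN => //; rewrite ltW.
have fnear n : \forall D \near (0 : R)^'+, f w n D = f w n 0.
  have Hp := ball_sum_near0 s (word_prob mu S letter)
    (word S letter n (path_of X w)) rho_ge0.
  have Hq := ball_sum_near0 s (word_weight q)
    (word S letter n (path_of X w)) rho_ge0.
  by near=> D; rewrite !fE (near Hp D)// (near Hq D).
have flim n : lim (f w n D @[D --> (0 : R)^'+]) = f w n 0.
  exact: lim_near_cst.
split; first by move=> n _; exact: is_cvg_near_cst (fnear n).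
apply: cvg_EFin; first exact: nearW.
apply/cvgrPdist_le => e e0; have [D0 [D00 HD]] := Hw e e0.
apply: filterS HD => n Hn /=; rewrite flim distrC.
by apply: Hn; rewrite lexx ltW.
Unshelve. all: by end_near. Qed.
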